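(* Let the covariance matrix $\Sigma\in\mathbb{R}^{p\times p}$ satisfy the RE condition on $\mathcal C_{WSGRE}(s,s_0,c_0)$, that is, $$\min_{v\in\mathcal C_{WSGRE}(s,s_0,c_0)\setminus\{0\}}\frac{\|\Sigma^{1/2}v\|_2}{\|v\|_2}=\kappa\in(0,1),$$ and the sparse group normalization condition $\sup_{S\in\mathcal S}\|\Sigma_S\|_{op}\le1$. Let the random design matrix be generated as $X=Z\Sigma^{1/2}\in\mathbb{R}^{n\times p}$, where the rows of $Z$ are i.i.d. isotropic sub-Gaussian random vectors in $\mathbb{R}^p$ with $\psi_2$ constant $\alpha$. If the sample size $n$ satisfies $$n>C_1\left(s\log\frac{4em}{s}+ss_0\log\frac{2ed}{s_0}\right),$$ then with probability not less than $1-\exp(-C_2n)$, for all $v\in\mathcal C_{WSGRE}(s,s_0,c_0)\setminus\{0\}$, $$\frac{\|Xv\|_n}{\|v\|_2}\ge\kappa',$$ where $C_1,C_2>0$ are absolute constants and $\kappa'\in(0,\kappa)$.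
   Context: $p=md$, $[p]$ is partitioned into $m$ groups $G_1,\dots,G_m$ with $|G_j|=d$; $s\in[m]$, $s_0\in[d]$; $c_0>0$. $\|w\|_n^2=\frac1n\sum_{i=1}^nw_i^2$ for $w\in\mathbb{R}^n$. $\mathcal S=\{S\subseteq[p]:|S|=s_0,\ S\subseteq G_i\text{ for some }i\in[m]\}$; $\Sigma_S$ is the principal submatrix of $\Sigma$ indexed by $S$, $\|\cdot\|_{op}$ the spectral norm. Weights (with some $\sigma>0$, whose value does not affect the cone below): $\lambda_j=\sigma\sqrt{\log\frac{2ed}{s_0}+\frac2{s_0}\log\frac{4em}{j}}$, $j\in[m]$; $\tilde\lambda_i=\lambda_{\lceil i/s_0\rceil}$ for $i\le s_0m$, $\tilde\lambda_i=\lambda_m$ for $s_0m<i\le p$. With $\delta_{i^*}$ the $i$-th largest absolute entry of $\delta\in\mathbb{R}^p$ and $\|\delta_{G_{j^*}}\|_2$ the $j$-th largest of the group norms $\|\delta_{G_k}\|_2$, $k\in[m]$: $\|\delta\|_*=\sum_{i=1}^p\tilde\lambda_i\delta_{i^*}+\sqrt{s_0}\sum_{j=1}^m\lambda_j\|\delta_{G_{j^*}}\|_2$, and $$\mathcal C_{WSGRE}(s,s_0,c_0)=\Big\{\delta\in\mathbb{R}^p:\|\delta\|_*\le(2+c_0)\sqrt{\textstyle\sum_{i=1}^{ss_0}\tilde\lambda_i^2}\,\|\delta\|_2\Big\}.$$ A random vector $Y$ in $\mathbb{R}^p$ is isotropic if $\mathbf E|\langle Y,y\rangle|^2=\|y\|_2^2$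 for all $y\in\mathbb{R}^p$, and sub-Gaussian with $\psi_2$ constant $\alpha$ if for every $y\in\mathbb{R}^p$, $\inf\{t>0:\mathbf E\exp(\langle Y,y\rangle^2/t^2)\le2\}\le\alpha\|y\|_2$.
   Formalization: The constants C_1, C_2 are not absolute but may depend on α, c_0, κ and κ' (κ' being any chosen number in (0,κ)); truly absolute constants are impossible, e.g. for large c_0 the cone is all of R^p and Xv=0 for some v≠0 when n<p. *)

(* Defs.v *)
(* MathComp / MathComp-Analysis *)
From HB Require Import structures.
From mathcomp Require Import all_boot all_order all_algebra.
From mathcomp Require Import all_classical all_reals all_analysis.

Set Implicit Arguments.
Unset Strict Implicit.
Unset Printing Implicit Defensive.

Import Order.TTheory GRing.Theory Num.Theory.
Import numFieldNormedType.Exports.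

Local Open Scope classical_set_scope.
Local Open Scope ring_scope.

(* The norms of [normedtype] on matrices are max-norms, hence the definitions
   of the Euclidean and spectral norms below. *)
Definition l2norm (R : realType) (k : nat) (x : 'cV[R]_k) : R :=
  Num.sqrt (\sum_(i < k) x i 0 ^+ 2).

Definition l2norm_on (R : realType) (k : nat) (A : {set 'I_k}) (x : 'cV[R]_k)
    : R :=
  Num.sqrt (\sum_(i in A) x i 0 ^+ 2).

Definition empnorm (R : realType) (n : nat) (w : 'cV[R]_n) : R :=
  Num.sqrt (n%:R^-1 * \sum_(i < n) w i 0 ^+ 2).

Definition opnorm (R : realType) (k : nat) (A : 'M[R]_k) : R :=
  sup [set l2norm (A *m x) | x in [set x : 'cV[R]_k | l2norm x <= 1]].

Definition principal_submx (R : realType) (p : nat) (S : {set 'I_p})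
    (A : 'M[R]_p) : 'M[R]_#|S| :=
  mxsub (@enum_val _ (mem S)) (@enum_val _ (mem S)) A.

Definition psdmx (R : realType) (p : nat) (A : 'M[R]_p) : Prop :=
  A^T = A /\ forall x : 'cV[R]_p, 0 <= (x^T *m A *m x) 0 0.

(* The positive semidefinite square root; the default value 0 is only reached
   when [A] is not positive semidefinite. *)
Definition sqrtmx (R : realType) (p : nat) (A : 'M[R]_p) : 'M[R]_p :=
  xget 0 [set B : 'M[R]_p | psdmx B /\ B *m B = A].

Definition grouping (p m d : nat) (G : 'I_m -> {set 'I_p}) : Prop :=
  (forall j, #|G j| = d) /\ (forall i, exists! j, i \in G j).

Definition sparse_supports (p m s0 : nat) (G : 'I_m -> {set 'I_p})
    : set {set 'I_p} :=
  [set S | #|S| = s0 /\ exists j, S \subset G j].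

(* The weights are indexed from 1, as are the ranks in [nth_largest]. *)
Definition lam (R : realType) (sigma : R) (m d s0 : nat) (j : nat) : R :=
  sigma * Num.sqrt (ln (2 * expR 1 * d%:R / s0%:R) +
                    2 / s0%:R * ln (4 * expR 1 * m%:R / j%:R)).

Definition ceil_divn (i k : nat) : nat := ((i + k).-1 %/ k)%N.

Definition tlam (R : realType) (sigma : R) (m d s0 : nat) (i : nat) : R :=
  if (i <= s0 * m)%N then lam sigma m d s0 (ceil_divn i s0)
  else lam sigma m d s0 m.

Definition nth_largest (R : realType) (l : seq R) (i : nat) : R :=
  nth 0 (sort >=%R l) i.-1.

Definition starnorm (R : realType) (sigma : R) (p m d s0 : nat)
    (G : 'I_m -> {set 'I_p}) (delta : 'cV[R]_p) : R :=
  \sum_(1 <= i < p.+1)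
     tlam sigma m d s0 i * nth_largest [seq `|delta k 0| | k : 'I_p] i +
  Num.sqrt s0%:R * \sum_(1 <= j < m.+1)
     lam sigma m d s0 j * nth_largest [seq l2norm_on (G k) delta | k : 'I_m] j.

Definition wsgre_cone (R : realType) (sigma : R) (p m d s s0 : nat) (c0 : R)
    (G : 'I_m -> {set 'I_p}) : set 'cV[R]_p :=
  [set delta | starnorm sigma d s0 G delta <=
     (2 + c0) * Num.sqrt (\sum_(1 <= i < (s * s0).+1) tlam sigma m d s0 i ^+ 2)
       * l2norm delta].

(* [kappa] is the minimum of [f] over [A]; in particular it is attained. *)
Definition is_min_over (R : realType) (U : Type) (A : set U) (f : U -> R)
    (kappa : R) : Prop :=
  (exists2 v, A v & f v = kappa) /\ forall v, A v -> kappa <= f v.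

(* A random vector of R^p is a random variable with values in [p.-tuple R],
   which carries the product (= Borel) sigma-algebra. *)
Definition tdot (R : realType) (p : nat) (Y : p.-tuple R) (y : 'cV[R]_p) : R :=
  \sum_(j < p) tnth Y j * y j 0.

Definition isotropic (disp : measure_display) (T : measurableType disp)
    (R : realType) (P : probability T R) (p : nat)
    (Y : {RV P >-> p.-tuple R}) : Prop :=
  forall y : 'cV[R]_p,
    ('E_P[(fun w => tdot (Y w) y ^+ 2)%R] = (l2norm y ^+ 2)%:E)%E.

(* The infimum is taken in the extended reals, so that it is +oo when no
   [t] is admissible. *)
Definition psi2norm (disp : measure_display) (T : measurableType disp)
    (R : realType) (P : probability T R) (X : T -> R) : \bar R :=
  ereal_inf [set t%:E | t in
    [set t : R | 0 < t /\ ('E_P[(fun w => expR (X w ^+ 2 / t ^+ 2))%R] <= 2%:E)%E]].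

Definition subgaussian (disp : measure_display) (T : measurableType disp)
    (R : realType) (P : probability T R) (p : nat) (alpha : R)
    (Y : {RV P >-> p.-tuple R}) : Prop :=
  forall y : 'cV[R]_p,
    (psi2norm P (fun w => tdot (Y w) y) <= (alpha * l2norm y)%:E)%E.

Definition mutually_independent (disp disp' : measure_display)
    (T : measurableType disp) (U : measurableType disp') (R : realType)
    (P : probability T R) (n : nat) (X : 'I_n -> {RV P >-> U}) : Prop :=
  forall (J : {set 'I_n}) (B : 'I_n -> set U), (forall i, measurable (B i)) ->
    P (\bigcap_(i in [set` J]) (X i @^-1` B i)) =
    (\prod_(i in J) P (X i @^-1` B i))%E.

Definition identically_distributed (disp disp' : measure_display)
    (T : measurableType disp) (U : measurableType disp') (R : realType)
    (P : probability T R) (n : nat) (X : 'I_n -> {RV P >-> U}) : Prop :=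
  forall (i k : 'I_n) (B : set U), measurable B ->
    distribution P (X i) B = distribution P (X k) B.

Definition row_matrix (disp : measure_display) (T : measurableType disp)
    (R : realType) (P : probability T R) (n p : nat)
    (Z : 'I_n -> {RV P >-> p.-tuple R}) (w : T) : 'M[R]_(n, p) :=
  \matrix_(i < n, j < p) tnth (Z i w) j.

(* Measures are total functions whose value on non-measurable sets carries no
   meaning: "A holds with probability at least q" is stated through a
   measurable event contained in A. *)
Definition holds_with_prob_ge (disp : measure_display)
    (T : measurableType disp) (R : realType) (P : probability T R) (q : R)
    (A : set T) : Prop :=
  exists E : set T, [/\ measurable E, E `<=` A & (q%:E <= P E)%E].

(* Main.v *)
Require Import Defs.
From HB Require Import structures.
From mathcomp Require Import all_boot all_order all_algebra.
From mathcomp Require Import all_classical all_reals all_analysis.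
From mathcomp Require Import measurable_realfun lra zify.

Set Implicit Arguments.
Unset Strict Implicit.
Unset Printing Implicit Defensive.

Import Order.TTheory GRing.Theory Num.Theory.
Import numFieldNormedType.Exports.

Local Open Scope classical_set_scope.
Local Open Scope ring_scope.

(** The uniform lower bound comes from a PAC-Bayes argument in which each
    vector of the cone is replaced by a random sum of simple vectors.  It uses
    no chaining, no covering of the cone and no symmetrization.

    _One vector._  For a fixed vector [u], the variables [<Z_i, u>^2] are
    independent and nonnegative, with mean [|u|^2] and second moment of order
    [alpha^4 |u|^4].  Hence the lower tail of their sum has a good Laplace
    transform ([sample_laplace]): the expectation of
    [exp (- lambda sum_i <Z_i, u>^2)] is at most
    [exp (- n lambda (1 - C lambda) min (|u|^2, 1))].

    _All vectors at once._  Divide these exponentials by their bounds and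
    average them over a fixed prior on finitely many vectors.  By Markov's
    inequality the average is at most [exp t] with probability at least
    [1 - exp (- t)], and by the Gibbs variational principle ([avg_ln]) the
    bound then holds on average under every other distribution, at the price
    of its relative entropy to the prior.  For [v] in the cone, normalized by
    [|B v| = 1] with [B] the square root of [Sigma], the distribution chosen
    is that of a sum [theta] of [K] independent letters, with mean [v]
    (Maurey's empirical method).  The mean of [|X theta|^2] exceeds [|X v|^2]
    by a variance term, and [B theta] is close to [B v], so that a lower bound
    for [|X v|^2] follows ([pac_bayes_lower]) as soon as the variance is small
    and the entropy is a small fraction of [n].

    _The letters._  An atom is an integer vector divided by [sqrt s0], with
    norm at most 2 and at most [s0] nonzero entries, all in one group.  Every
    vector [v_G] supported in a group is a nonnegative combination of atoms,
    of total weight [N_G = 2 |v_G|_2 + |v_G|_1 / sqrt s0] ([atomic_group]).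
    The normalization of [Sigma] bounds [B] on atoms, and there are so few
    atoms ([card_atoms]) that [X] is bounded on all of them simultaneously.
    With [mu_r = sqrt s0 lambda_r / sigma], a group whose weight [N_G] has rank
    [r] contributes letters of length about [mu_r] times a constant, drawn with
    probability proportional to [N_G / mu_r].  Then the variance is of order
    [H^2 / K] and the entropy of one letter is bounded ([posterior_exists]),
    where [H] bounds the sum of the [N_G mu_r].  The decreasing weights are
    essential here: they make the entropy of the choice of the group of order
    [log (m / r)] instead of [log m], and this is dominated by [mu_r^2].

    _The cone._  By the rearrangement inequality the sum of the [N_G mu_r] is
    at most a constant times [|v|_*] ([starnorm_ge]), hence on the cone at most
    a constant times the square root of
    [A = s log (4em/s) + s s0 log (2ed/s0)] ([cone_gauge]).  So [K] of order
    [A] makes the variance as small as desired, with an entropy of order [A],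
    which the assumption on [n] makes small compared with [n]. *)

(** * Expectations of products of independent variables *)

Section IndependentProducts.
Context (disp disp' : measure_display) (T : measurableType disp)
        (U : measurableType disp') (R : realType) (P : probability T R).

Import HBNNSimple.

(** Replaces an indicator by a function in a product formula: both sides are
    measures in [B], and [g] is an increasing limit of simple functions. *)
Lemma weighted_integral_comp (F : T -> R) (Y : {RV P >-> U}) (c : R) :
  measurable_fun setT F -> (forall w, 0 <= F w) -> 0 <= c ->
  (forall B, measurable B ->
     (\int[P]_w (F w * \1_B (Y w))%:E = c%:E * P (Y @^-1` B))%E) ->
  forall g : U -> R, measurable_fun setT g -> (forall u, 0 <= g u) ->
  (\int[P]_w (F w * g (Y w))%:E = c%:E * \int[P]_w (g (Y w))%:E)%E.
Proof.
move=> mF F0 c0 FB g mg g0.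
have mgE : measurable_fun [set: U] (fun u => (g u)%:E) by exact/measurable_EFinP.
pose h := nnsfun_approx measurableT mgE.
have hcvg u : (EFin \o h^~ u) @ \oo --> (g u)%:E.
  by apply: (@cvg_nnsfun_approx _ _ _ _ measurableT _ mgE) => // x _; rewrite lee_fin.
have mhY n : measurable_fun [set: T] (fun w => h n (Y w)).
  by apply: measurableT_comp => //; exact: measurable_funP.
have mI (A : set U) : measurable A ->
    measurable_fun [set: T] (fun w => \1_A (Y w) : R).
  move=> mA; apply: measurableT_comp => //; exact: measurable_funP.
have hsimple n : (\int[P]_w (F w * h n (Y w))%:E
    = c%:E * \int[P]_w (h n (Y w))%:E)%E.
  have mpre y : measurable (h n @^-1` [set y]) by exact: measurable_sfunP.
  have fin : finite_set (range (h n)) by exact: fimfunP.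
  have E1 w : (h n (Y w))%:E = (\sum_(y \in range (h n))
      (y * \1_(h n @^-1` [set y]) (Y w))%:E)%E by rewrite fsumEFin// -fimfunE.
  have yI0 y u : 0 <= y * \1_(h n @^-1` [set y]) u :> R.
    rewrite indicE; case: (boolP (u \in _)) => [|_]; last by rewrite mulr0.
    by rewrite inE /= => <-; rewrite mulr1.
  have -> : (\int[P]_w (h n (Y w))%:E = \sum_(y \in range (h n))
      (y%:E * P (Y @^-1` (h n @^-1` [set y]))))%E.
    under eq_integral do rewrite E1.
    rewrite ge0_integral_fsum//; last 2 first.
    - by move=> y; apply/measurable_EFinP; apply: measurable_funM => //; exact: mI.
    - by move=> y w _; rewrite lee_fin.
    apply: eq_fsbigr => y _.
    rewrite (_ : (fun x => _) = fun w =>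
      (y * \1_(Y @^-1` (h n @^-1` [set y])) w)%:E)//.
    rewrite -[X in P X]setIT -integral_indic//; last first.
      rewrite -[_ @^-1` _]setTI; exact: measurable_funP.
    rewrite (@integralZl_indic _ _ _ P _ measurableT
      (fun y => Y @^-1` (h n @^-1` [set y])))//.
      move=> ylt0; apply/seteqP; split => // w /= hy.
      by have : 0 <= h n (Y w) by []; rewrite hy leNgt ylt0.
    rewrite -[_ @^-1` _]setTI; exact: measurable_funP.
  under eq_integral.
    move=> w _; rewrite EFinM E1 ge0_mule_fsumr; last first.
      by move=> y; rewrite lee_fin.
    under eq_fsbigr do rewrite -EFinM mulrCA EFinM.
    over.
  rewrite ge0_integral_fsum//; last 2 first.
  - move=> y; apply/measurable_EFinP; apply: measurable_funM => //.
    by apply: measurable_funM => //; exact: mI.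
  - by move=> y w _; rewrite -EFinM lee_fin mulrCA mulr_ge0.
  rewrite ge0_mule_fsumr; last first.
    move=> y; have [y0|y0] := leP 0 y; first by rewrite mule_ge0 ?lee_fin.
    rewrite (_ : _ @^-1` _ = set0) ?measure0 ?mule0//.
    apply/seteqP; split => // w /= hy.
    by have : 0 <= h n (Y w) by []; rewrite hy leNgt y0.
  apply: eq_fsbigr => y /[!inE] -[u _ hu].
  have y0 : 0 <= y by rewrite -hu.
  rewrite ge0_integralZl_EFin//; last 2 first.
  - by move=> w _; rewrite lee_fin mulr_ge0.
  - by apply/measurable_EFinP; apply: measurable_funM => //; exact: mI.
  by rewrite FB// muleCA.
have -> : (\int[P]_w (F w * g (Y w))%:E =
    lim (\int[P]_w (F w * h n (Y w))%:E @[n --> \oo]))%E.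
  have FE w : (F w * g (Y w))%:E = lim ((F w * h n (Y w))%:E @[n --> \oo])%E.
    apply/esym/cvg_lim => //; rewrite EFinM.
    by under eq_fun do rewrite EFinM; apply: cvgeZl => //; exact: hcvg.
  under eq_integral do rewrite FE.
  apply: monotone_convergence => //.
  - by move=> n; apply/measurable_EFinP; exact: measurable_funM.
  - by move=> n w _; rewrite lee_fin mulr_ge0.
  - move=> w _ a b ab; rewrite lee_fin ler_wpM2l//.
    exact/lefP/nd_nnsfun_approx.
have -> : (\int[P]_w (g (Y w))%:E =
    lim (\int[P]_w (h n (Y w))%:E @[n --> \oo]))%E.
  have gE w : (g (Y w))%:E = lim ((h n (Y w))%:E @[n --> \oo])%E.
    by apply/esym/cvg_lim => //; exact: hcvg.
  under eq_integral do rewrite gE.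
  apply: monotone_convergence => //.
  - by move=> n; apply/measurable_EFinP.
  - by move=> n w _; rewrite lee_fin.
  - by move=> w _ a b ab; rewrite lee_fin; exact/lefP/nd_nnsfun_approx.
under eq_fun do rewrite hsimple.
have : cvgn (fun n => \int[P]_w (h n (Y w))%:E)%E.
  apply: ereal_nondecreasing_is_cvgn => a b ab; apply: ge0_le_integral => //.
  - by move=> w _; rewrite lee_fin.
  - exact/measurable_EFinP.
  - exact/measurable_EFinP.
  - by move=> w _; rewrite lee_fin; exact/lefP/nd_nnsfun_approx.
by move=> cv; apply: cvg_lim => //; apply: cvgeZl.
Qed.

(** Independence gives the formula for indicators; [weighted_integral_comp]
    turns the factors into general functions one at a time. *)
Lemma independent_integral_prod (n : nat) (Z : 'I_n -> {RV P >-> U})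
    (g : 'I_n -> U -> R) (e : 'I_n -> R) :
  mutually_independent Z ->
  (forall i, measurable_fun setT (g i)) -> (forall i u, 0 <= g i u) ->
  (forall i, \int[P]_w (g i (Z i w))%:E = (e i)%:E)%E ->
  (\int[P]_w (\prod_(i < n) g i (Z i w))%:E = (\prod_(i < n) e i)%:E)%E.
Proof.
move=> indep mg g0 ge.
(* the first [k] factors are arbitrary and the others are indicators *)
suff H k (h : 'I_n -> U -> R) (f : 'I_n -> R) : (k <= n)%N ->
    (forall i, measurable_fun setT (h i)) -> (forall i u, 0 <= h i u) ->
    (forall i : 'I_n, (k <= i)%N -> exists2 B, measurable B & h i = \1_B) ->
    (forall i, \int[P]_w (h i (Z i w))%:E = (f i)%:E)%E ->
    (\int[P]_w (\prod_(i < n) h i (Z i w))%:E = (\prod_(i < n) f i)%:E)%E.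
  apply: (H n) => // i; by rewrite leqNgt ltn_ord.
elim: k h f => [|k IH] h f.
  move=> _ mh h0 hB hf.
  have /choice[B HB] : forall i, exists B : set U, measurable B /\ h i = \1_B.
    by move=> i; have [B ? ?] := hB i (leq0n _); exists B.
  have mZB i : measurable (Z i @^-1` B i).
    by rewrite -[_ @^-1` _]setTI; apply: measurable_funP => //; apply (HB i).1.
  have E0 : (fun w => (\prod_(i < n) h i (Z i w))%:E) =
     (fun w => (\1_(\bigcap_(i in [set` [set: 'I_n]%SET]) (Z i @^-1` B i)) w : R)%:E).
    apply/funext => w; congr EFin; rewrite indicE.
    have [wB|wB] := boolP (w \in _).
      rewrite big1// => i _; rewrite (HB i).2 indicE mem_set//.
      by move: wB; rewrite inE => /(_ i); apply; rewrite /= inE.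
    have : ~ (forall i, B i (Z i w)).
      by move=> H; move: wB; rewrite notin_setE; apply => i _; exact: H.
    move/existsNP => [i nBi].
    by rewrite (bigD1 i)//= (HB i).2 indicE memNset// mul0r.
  rewrite E0 integral_indic//; last first.
    apply: fin_bigcap_measurable => //; exact: finite_finset.
  rewrite setIT; apply: etrans (indep [set: 'I_n]%SET B (fun i => (HB i).1)) _.
  rewrite -prodEFin; apply: eq_big => [i|i _]; first by rewrite inE.
  rewrite -hf (HB i).2 -[X in P X]setIT -integral_indic//.
move=> kn mh h0 hB hf.
pose j := Ordinal kn.
pose F w := \prod_(i < n | i != j) h i (Z i w).
have e0 i : 0 <= f i.
  by rewrite -lee_fin -hf; apply: integral_ge0 => w _; rewrite lee_fin.
have mhZ i : measurable_fun [set: T] (fun w => h i (Z i w)).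
  by apply: measurableT_comp => //; exact: measurable_funP.
have -> : (fun w => (\prod_(i < n) h i (Z i w))%:E) =
    (fun w => (F w * h j (Z j w))%:E).
  by apply/funext => w; rewrite (bigD1 j)//= mulrC.
rewrite (bigD1 j)//= mulrC EFinM -hf.
apply: weighted_integral_comp => //.
- rewrite (_ : F = fun w => \prod_(i < n) if i != j then h i (Z i w) else 1).
    by apply: measurable_prod => i _; case: (i != j).
  by apply/funext => w; rewrite /F big_mkcond.
- by move=> w; apply: prodr_ge0.
- by apply: prodr_ge0.
move=> B mB.
have mZB : measurable (Z j @^-1` B).
  by rewrite -[_ @^-1` _]setTI; exact: measurable_funP.
pose h' i := if i == j then \1_B else h i.
pose f' i := if i == j then fine (P (Z j @^-1` B)) else f i.
have := IH h' f' (ltnW kn); rewrite (bigD1 j)//= /f' eqxx.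
under eq_bigr => i /negPf-> do over.
have FE : (fun w => (\prod_(i < n) h' i (Z i w))%:E) =
    (fun w => (F w * \1_B (Z j w))%:E).
  apply/funext => w; rewrite (bigD1 j)//= mulrC /h' eqxx; congr (_ * _)%:E.
  by apply: eq_bigr => i /negPf ->.
rewrite FE => ->.
- by rewrite EFinM muleC fineK// fin_num_measure.
- by move=> i; rewrite /h'; case: ifP => // _; exact: measurable_indic.
- by move=> i u; rewrite /h'; case: ifP.
- move=> i ki; rewrite /h'; case: ifPn => [_|ij]; first by exists B.
  apply: hB; rewrite ltn_neqAle ki andbT; apply: contra ij => /eqP ki'.
  by apply/eqP/val_inj.
- move=> i; rewrite /h'; case: ifPn => [/eqP ->|_]; last exact: hf.
  rewrite fineK ?fin_num_measure// -[X in P X]setIT -integral_indic//.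
Qed.

End IndependentProducts.

(** * Laplace transforms of squared sub-Gaussian marginals *)

Definition sqnorm (R : realType) (k : nat) (x : 'cV[R]_k) : R :=
  \sum_(i < k) x i 0 ^+ 2.

Lemma sqnorm_ge0 (R : realType) (k : nat) (x : 'cV[R]_k) : 0 <= sqnorm x.
Proof. by apply: sumr_ge0 => i _; exact: sqr_ge0. Qed.

Lemma sqr_l2norm (R : realType) (k : nat) (x : 'cV[R]_k) :
  l2norm x ^+ 2 = sqnorm x.
Proof. by rewrite sqr_sqrtr ?sqnorm_ge0. Qed.

Lemma sqnormZ (R : realType) (k : nat) (c : R) (y : 'cV[R]_k) :
  sqnorm (c *: y) = c ^+ 2 * sqnorm y.
Proof. by rewrite /sqnorm mulr_sumr; apply: eq_bigr => i _; rewrite mxE exprMn. Qed.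

Lemma sqnorm0 (R : realType) (k : nat) : sqnorm (0 : 'cV[R]_k) = 0.
Proof. by rewrite /sqnorm big1// => i _; rewrite mxE expr0n. Qed.

Lemma l2norm_eq0 (R : realType) (k : nat) (x : 'cV[R]_k) : l2norm x = 0 -> x = 0.
Proof.
move=> x0; apply/matrixP => i j; rewrite ord1 mxE; apply/eqP; rewrite -sqrf_eq0.
have /eqP : sqnorm x = 0 by rewrite -sqr_l2norm x0 expr0n.
rewrite psumr_eq0; last by move=> l _; exact: sqr_ge0.
by move=> /allP/(_ i); rewrite mem_index_enum => /(_ isT).
Qed.

(** From [1 + x <= expR x] and [(1 - x + x ^+ 2) * (1 + x) = 1 + x ^+ 3]. *)
Lemma expRN_le (R : realType) (x : R) : 0 <= x -> expR (- x) <= 1 - x + x ^+ 2.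
Proof.
move=> x0; have x1 : 0 < 1 + x by lra.
rewrite expRN -[_^-1]mul1r ler_pdivrMr ?expR_gt0//.
apply: (@le_trans _ _ ((1 - x + x ^+ 2) * (1 + x))).
  have : 0 <= x ^+ 3 by rewrite exprn_ge0.
  by lra.
by apply: ler_wpM2l; [nra|exact: expR_ge1Dx].
Qed.

Lemma le1_ln (R : realType) (u : R) : 0 < u -> ln u <= u - 1.
Proof. by move=> u0; have := expR_ge1Dx (ln u); rewrite lnK ?posrE//; lra. Qed.

Section SubGaussianLaplace.
Context (disp : measure_display) (T : measurableType disp) (R : realType)
        (P : probability T R) (p : nat).

Lemma measurable_tdot (y : 'cV[R]_p) :
  measurable_fun setT (fun u : p.-tuple R => tdot u y).
Proof.
apply: measurable_sum => j; apply: measurable_funM => //.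
exact: measurable_tnth.
Qed.

Variables (alpha : R) (Y : {RV P >-> p.-tuple R}).
Hypotheses (alpha_gt0 : 0 < alpha) (subY : subgaussian alpha Y).

Let mY y : measurable_fun setT (fun w => tdot (Y w) y).
Proof.
apply: (measurableT_comp (measurable_tdot y)); exact: measurable_funP.
Qed.

(** The infimum defining the [psi2norm] need not be attained, hence the strict
    inequality. *)
Lemma subgaussian_exp_moment (y : 'cV[R]_p) (t : R) :
  alpha * l2norm y < t ->
  (\int[P]_w (expR (tdot (Y w) y ^+ 2 / t ^+ 2))%:E <= 2%:E)%E.
Proof.
move=> yt; have : (psi2norm P (fun w => tdot (Y w) y) < t%:E)%E.
  by apply: le_lt_trans (subY y) _; rewrite lte_fin.
move=> /ereal_inf_lt[_ [s [s0 sE] <-]]; rewrite lte_fin => st.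
apply: le_trans sE; rewrite unlock; apply: ge0_le_integral => //.
- apply/measurable_EFinP/measurableT_comp => //.
  by apply: measurable_funM => //; exact: measurable_funX.
- apply/measurable_EFinP/measurableT_comp => //.
  by apply: measurable_funM => //; exact: measurable_funX.
- move=> w _; rewrite lee_fin ler_expR ler_wpM2l ?sqr_ge0//.
  rewrite lef_pV2 ?posrE ?exprn_gt0// ?(lt_trans s0 st)//.
  by rewrite lerXn2r ?nnegrE ?(ltW s0)// ltW// (lt_trans s0 st).
Qed.

Hypothesis isoY : isotropic Y.

(** By [expRN_le] only the second and the fourth moments matter, and the
    exponential moment bounds the fourth one.  Cutting [sqnorm y] off at 1 keeps
    the quadratic error term below a multiple of the main term: since the
    Laplace transform decreases in the length of [y], a longer [y] can first be
    shortened to length 1. *)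
Lemma subgaussian_laplace (y : 'cV[R]_p) (lambda : R) : 0 < lambda ->
  (\int[P]_w (expR (- (lambda * tdot (Y w) y ^+ 2)))%:E <=
   (expR (- (lambda * (1 - 64 * alpha ^+ 4 * lambda) *
             Num.min (sqnorm y) 1)))%:E)%E.
Proof.
move=> l0.
have [q0|q0] := eqVneq (sqnorm y) 0.
  rewrite q0 min_l// mulr0 oppr0 expR0.
  rewrite -[leRHS](@probability_setT _ _ _ P) -[leRHS]mul1e -integral_cst//.
  apply: ge0_le_integral => //.
  - apply/measurable_EFinP/measurableT_comp => //; apply: measurableT_comp => //.
    by apply: measurable_funM => //; exact: measurable_funX.
  - move=> w _; rewrite lee_fin -[leRHS]expR0 ler_expR oppr_le0.
    by rewrite mulr_ge0 ?sqr_ge0// ltW.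
have {}q0 : 0 < sqnorm y by rewrite lt_neqAle eq_sym q0 sqnorm_ge0.
set q := sqnorm y in q0 *; set r2 := Num.min q 1.
have r2q : r2 <= q by rewrite ge_min lexx.
have r21 : r2 <= 1 by rewrite ge_min lexx orbT.
have r20 : 0 < r2 by rewrite lt_min q0 ltr01.
(* shortening factor, squared, for which the shortened vector has squared norm [r2] *)
pose s2 := r2 / q.
have s20 : 0 < s2 by rewrite divr_gt0.
have s21 : s2 <= 1 by rewrite ler_pdivrMr// mul1r.
pose t := 2 * alpha * l2norm y.
have ny0 : 0 < l2norm y by rewrite sqrtr_gt0.
have t0 : 0 < t by rewrite !mulr_gt0.
have yt : alpha * l2norm y < t.
  by have := mulr_gt0 alpha_gt0 ny0; rewrite /t; lra.
pose K := 2 * (lambda * s2 * t ^+ 2) ^+ 2.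
have K0 : 0 <= K by rewrite mulr_ge0 ?sqr_ge0.
pose x w := lambda * s2 * tdot (Y w) y ^+ 2.
have x0 w : 0 <= x w by rewrite mulr_ge0 ?sqr_ge0// mulr_ge0 ?ltW.
pose g w := expR (tdot (Y w) y ^+ 2 / t ^+ 2).
have mx : measurable_fun [set: T] x.
  by apply: measurable_funM => //; exact: measurable_funX.
have mg : measurable_fun [set: T] g.
  apply: measurableT_comp => //.
  by apply: measurable_funM => //; exact: measurable_funX.
have pt w : expR (- (lambda * tdot (Y w) y ^+ 2)) + x w <= 1 + K * g w.
  have H1 : expR (- (lambda * tdot (Y w) y ^+ 2)) <= expR (- x w).
    rewrite ler_expR lerN2 /x -mulrA ler_wpM2l ?(ltW l0)//.
    by rewrite ler_piMl// sqr_ge0.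
  have H2 := expRN_le (x0 w).
  suff : x w ^+ 2 <= K * g w by lra.
  have H3 : (tdot (Y w) y ^+ 2 / t ^+ 2) ^+ 2 <= 2 * g w.
    have B0 : 0 <= tdot (Y w) y ^+ 2 / t ^+ 2 by rewrite divr_ge0 ?sqr_ge0.
    have := expR_ge1Dxn 1 B0; rewrite /g.
    set B := tdot _ _ ^+ 2 / _ in B0 *; set A := expR _.
    by rewrite (_ : _`!%:R = 2 :> R)//; lra.
  have -> : x w ^+ 2 = (lambda * s2 * t ^+ 2) ^+ 2 *
      (tdot (Y w) y ^+ 2 / t ^+ 2) ^+ 2.
    rewrite -exprMn; congr (_ ^+ 2); rewrite /x [RHS]mulrA [in RHS]mulrAC.
    by rewrite mulfK// gt_eqF// exprn_gt0.
  rewrite (_ : K * g w = (lambda * s2 * t ^+ 2) ^+ 2 * (2 * g w)); last by rewrite /K; lra.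
  by apply: ler_wpM2l => //; exact: sqr_ge0.
have I1 : (\int[P]_w (expR (- (lambda * tdot (Y w) y ^+ 2)))%:E + (lambda * r2)%:E
    <= (1 + K * 2)%:E)%E.
  have -> : (lambda * r2)%:E = (\int[P]_w (x w)%:E)%E.
    under eq_integral do rewrite EFinM.
    rewrite ge0_integralZl_EFin//; last 3 first.
    - by move=> w _; rewrite lee_fin sqr_ge0.
    - by apply/measurable_EFinP; exact: measurable_funX.
    - by rewrite mulr_ge0// ltW.
    have := isoY y; rewrite unlock => ->; rewrite sqr_l2norm -/q -EFinM.
    by congr EFin; rewrite /s2 -!mulrA mulVf ?mulr1// gt_eqF.
  rewrite -ge0_integralD//; last 3 first.
  - apply/measurable_EFinP/measurableT_comp => //; apply: measurableT_comp => //.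
    by apply: measurable_funM => //; exact: measurable_funX.
  - by move=> w _; rewrite lee_fin.
  - exact/measurable_EFinP.
  apply: (@le_trans _ _ (\int[P]_w (1%:E + K%:E * (g w)%:E))%E).
    apply: ge0_le_integral => //.
    - by move=> w _; rewrite -EFinD lee_fin addr_ge0 ?expR_ge0.
    - apply: emeasurable_funD; apply/measurable_EFinP => //.
      apply: measurableT_comp => //; apply: measurableT_comp => //.
      by apply: measurable_funM => //; exact: measurable_funX.
    - apply: emeasurable_funD => //.
      by apply/measurable_EFinP/measurable_funM.
    - by move=> w _; rewrite -EFinM -!EFinD lee_fin.
  rewrite ge0_integralD//; last 2 first.
  - by move=> w _; rewrite -EFinM lee_fin mulr_ge0// expR_ge0.
  - by apply/measurable_EFinP/measurable_funM.
  have -> : (\int[P]__ 1 = 1%:E)%E.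
    by rewrite integral_cst// mul1e; exact: probability_setT.
  rewrite ge0_integralZl_EFin//; last 2 first.
  - by move=> w _; rewrite lee_fin /g expR_ge0.
  - exact/measurable_EFinP.
  rewrite EFinD; apply: leeD2l; rewrite (EFinM K); apply: lee_wpmul2l => //.
  exact: subgaussian_exp_moment.
rewrite -(@leeD2rE _ (lambda * r2)%:E)//.
apply: le_trans I1 _; rewrite -EFinD lee_fin.
have := expR_ge1Dx (- (lambda * (1 - 64 * alpha ^+ 4 * lambda) * r2)).
set E := expR _.
suff -> : K * 2 = 64 * alpha ^+ 4 * (lambda * r2) ^+ 2.
  have : 0 <= 64 * alpha ^+ 4 * lambda ^+ 2 * (r2 * (1 - r2)).
    have a4 : 0 < alpha ^+ 4 by rewrite exprn_gt0.
    have := sqr_ge0 lambda; move: (alpha ^+ 4) a4 (lambda ^+ 2) => a a4 l2 l2_0.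
    by rewrite mulr_ge0 ?mulr_ge0 ?subr_ge0// ltW.
  lra.
have -> : K = 32 * alpha ^+ 4 * (lambda * s2 * q) ^+ 2.
  by rewrite /K /t !exprMn sqr_l2norm -/q; lra.
rewrite -[_ * s2 * q]mulrA /s2 mulfVK ?gt_eqF//; lra.
Qed.

End SubGaussianLaplace.

(** * Exponential moments of the sample *)

Section Sample.
Context (disp : measure_display) (T : measurableType disp) (R : realType)
        (P : probability T R) (p n : nat) (alpha : R)
        (Z : 'I_n -> {RV P >-> p.-tuple R}).
Hypotheses (alpha_gt0 : 0 < alpha) (indepZ : mutually_independent Z)
           (subZ : forall i, subgaussian alpha (Z i)).

Lemma independent_integral_prod_le (g : p.-tuple R -> R) (b : R) :
  measurable_fun setT g -> (forall u, 0 <= g u) ->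
  (forall i, \int[P]_w (g (Z i w))%:E <= b%:E)%E ->
  (\int[P]_w (\prod_(i < n) g (Z i w))%:E <= (b ^+ n)%:E)%E.
Proof.
move=> mg g0 gb.
have ge0 i : (0 <= \int[P]_w (g (Z i w))%:E)%E.
  by apply: integral_ge0 => w _; rewrite lee_fin.
pose e i := fine (\int[P]_w (g (Z i w))%:E)%E.
have ge i : (\int[P]_w (g (Z i w))%:E = (e i)%:E)%E.
  by rewrite fineK// ge0_fin_numE// (le_lt_trans (gb i))// ltry.
rewrite (independent_integral_prod indepZ (fun _ => mg) (fun _ => g0) ge).
rewrite lee_fin (_ : b ^+ n = \prod_(i < n) b); last first.
  by rewrite prodr_const card_ord.
apply: ler_prod => i _; rewrite -!lee_fin.
by move: (ge0 i) (gb i); rewrite ge => -> ->.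
Qed.

Lemma sample_exp_moment (y : 'cV[R]_p) (t : R) : alpha * l2norm y < t ->
  (\int[P]_w (expR ((\sum_(i < n) tdot (Z i w) y ^+ 2) / t ^+ 2))%:E <=
   (2 ^+ n)%:E)%E.
Proof.
move=> yt.
under eq_integral do rewrite mulr_suml expR_sum.
apply: (independent_integral_prod_le
  (g := fun u => expR (tdot u y ^+ 2 / t ^+ 2))).
- apply: measurableT_comp => //; apply: measurable_funM => //.
  by apply: measurable_funX; exact: measurable_tdot.
- by move=> u; exact: expR_ge0.
- by move=> i; exact: subgaussian_exp_moment.
Qed.

Hypothesis isoZ : forall i, isotropic (Z i).

Lemma sample_laplace (y : 'cV[R]_p) (lambda : R) : 0 < lambda ->
  (\int[P]_w (expR (- (lambda * \sum_(i < n) tdot (Z i w) y ^+ 2) +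
     n%:R * (lambda * (1 - 64 * alpha ^+ 4 * lambda) * Num.min (sqnorm y) 1)))%:E
   <= 1)%E.
Proof.
move=> l0; set b := lambda * _ * _.
have mg : measurable_fun setT
    (fun u : p.-tuple R => expR (- (lambda * tdot u y ^+ 2))).
  apply: measurableT_comp => //; apply: measurableT_comp => //.
  apply: measurable_funM => //.
  by apply: measurable_funX; exact: measurable_tdot.
have mgZ i : measurable_fun [set: T] (fun w => expR (- (lambda * tdot (Z i w) y ^+ 2))).
  by apply: (measurableT_comp mg); exact: measurable_funP.
under eq_integral => w _.
  rewrite expRD mulr_sumr -sumrN expR_sum mulrC EFinM; over.
rewrite ge0_integralZl_EFin ?expR_ge0//=; last 2 first.
- by move=> w _; rewrite lee_fin prodr_ge0// => i _; exact: expR_ge0.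
- by apply/measurable_EFinP/measurable_prod => i _.
apply: (@le_trans _ _ ((expR (n%:R * b))%:E * ((expR (- b)) ^+ n)%:E)%E).
  apply: lee_wpmul2l; first by rewrite lee_fin expR_ge0.
  apply: (independent_integral_prod_le mg) => [u|i]; first exact: expR_ge0.
  exact: subgaussian_laplace.
by rewrite -EFinM -expRM_natl -expRD mulrN subrr expR0.
Qed.

End Sample.

(** * Averages over sums of independent letters *)

Section IteratedAverage.
Context (R : realType) (V : zmodType) (L : finType) (x : L -> V).

(** The expectation of [F (y + x l_1 + ... + x l_k)] for independent letters of
    law [rho].  The recursive form avoids product measures, and makes the moment
    computation and the entropy bound short inductions on [k]. *)
Fixpoint avg (rho : L -> R) (k : nat) (F : V -> R) (y : V) : R :=
  if k is k'.+1 then \sum_l rho l * avg rho k' F (y + x l) else F y.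

Lemma le_avg (rho : L -> R) (k : nat) (F G : V -> R) (y : V) :
  (forall l, 0 <= rho l) -> (forall z, F z <= G z) ->
  avg rho k F y <= avg rho k G y.
Proof.
move=> rho0 FG; elim: k y => [|k IH] y //=.
by apply: ler_sum => l _; rewrite ler_wpM2l.
Qed.

Lemma avg_ge0 (rho : L -> R) (k : nat) (F : V -> R) (y : V) :
  (forall l, 0 <= rho l) -> (forall z, 0 <= F z) -> 0 <= avg rho k F y.
Proof.
move=> rho0 F0; elim: k y => [|k IH] y //=.
by apply: sumr_ge0 => l _; exact: mulr_ge0.
Qed.

Lemma avgD (rho : L -> R) (k : nat) (F G : V -> R) (y : V) :
  avg rho k (fun z => F z + G z) y = avg rho k F y + avg rho k G y.
Proof.
elim: k y => [|k IH] y //=; rewrite -big_split/=.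
by apply: eq_bigr => l _; rewrite IH mulrDr.
Qed.

Lemma avgZ (rho : L -> R) (k : nat) (a : R) (F : V -> R) (y : V) :
  avg rho k (fun z => a * F z) y = a * avg rho k F y.
Proof.
elim: k y => [|k IH] y //=; rewrite mulr_sumr.
by apply: eq_bigr => l _; rewrite IH mulrCA.
Qed.

Lemma avg_sum (rho : L -> R) (k : nat) (I : finType) (F : I -> V -> R) (y : V) :
  avg rho k (fun z => \sum_i F i z) y = \sum_i avg rho k (F i) y.
Proof.
elim: k y => [|k IH] y //=; rewrite exchange_big/=.
by apply: eq_bigr => l _; rewrite IH mulr_sumr.
Qed.

Lemma avg_cst (rho : L -> R) (k : nat) (c : R) (y : V) :
  \sum_l rho l = 1 -> avg rho k (fun=> c) y = c.
Proof.
move=> rho1; elim: k y => [|k IH] y //=.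
by under eq_bigr do rewrite IH; rewrite -mulr_suml rho1 mul1r.
Qed.

(** Bias-variance decomposition. *)
Lemma avg_sqr (rho : L -> R) (k : nat) (g : V -> R) (a : R) (y : V) :
  {morph g : z z' / z + z'} -> \sum_l rho l = 1 ->
  avg rho k (fun z => (g z - a) ^+ 2) y =
  (g y + k%:R * (\sum_l rho l * g (x l)) - a) ^+ 2 +
  k%:R * (\sum_l rho l * g (x l) ^+ 2 - (\sum_l rho l * g (x l)) ^+ 2).
Proof.
move=> gD rho1; set m := \sum_l rho l * g (x l); set v := \sum_l rho l * _ ^+ 2.
elim: k y => [|k IH] y /=; first by rewrite !mul0r !addr0.
under eq_bigr => l _.
  rewrite IH gD (_ : _ * _ = rho l *
    ((g y + k%:R * m - a) ^+ 2 + k%:R * (v - m ^+ 2)) +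
    (2 * (g y + k%:R * m - a)) * (rho l * g (x l)) +
    rho l * g (x l) ^+ 2); last by lra.
  over.
rewrite !big_split/= -mulr_suml rho1 -mulr_sumr -/m -/v -natr1; lra.
Qed.

Lemma ex_weight_gt0 (rho : L -> R) :
  (forall l, 0 <= rho l) -> \sum_l rho l = 1 -> exists l, 0 < rho l.
Proof.
move=> rho0 rho1; apply/existsP; apply: contraT; rewrite negb_exists => /forallP r0.
move: rho1; rewrite big1 => [/eqP|l _]; first by rewrite eq_sym oner_eq0.
by apply/eqP; move: (r0 l); rewrite lt_neqAle rho0 andbT negbK eq_sym.
Qed.

(** The Gibbs (Donsker-Varadhan) variational principle on a finite set, from
    [ln u <= u - 1] applied to [pi l * W l / (S * rho l)]. *)
Lemma gibbs_variational (pi rho W : L -> R) :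
  (forall l, 0 <= pi l) -> (forall l, 0 <= rho l) -> \sum_l rho l = 1 ->
  (forall l, 0 < rho l -> 0 < pi l) -> (forall l, 0 < W l) ->
  \sum_l rho l * ln (W l) - \sum_l rho l * ln (rho l / pi l) <=
  ln (\sum_l pi l * W l).
Proof.
move=> pi0 rho0 rho1 ac W0; set S := \sum_l pi l * W l.
have S0 : 0 < S.
  have [l rl] := ex_weight_gt0 rho0 rho1.
  rewrite /S (bigD1 l)//= ltr_pwDl ?mulr_gt0 ?ac//.
  by apply: sumr_ge0 => i _; rewrite mulr_ge0// ltW.
rewrite -[leRHS]mul1r -rho1 mulr_suml -sumrB -subr_le0 -sumrB.
apply: (@le_trans _ _ (\sum_l (pi l * W l / S - rho l))).
  apply: ler_sum => l _.
  have [r0|r0] := eqVneq (rho l) 0.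
    by rewrite r0 !mul0r !subr0 divr_ge0 ?mulr_ge0// ltW.
  have {}r0 : 0 < rho l by rewrite lt_neqAle eq_sym r0 rho0.
  have p0 := ac l r0.
  have u0 : 0 < pi l * W l / S / rho l by rewrite !divr_gt0 ?mulr_gt0.
  have := le1_ln u0.
  have -> : ln (pi l * W l / S / rho l) = ln (W l) - ln (rho l / pi l) - ln S.
    rewrite !ln_div ?posrE ?divr_gt0 ?mulr_gt0// lnM ?posrE//; lra.
  move=> /(ler_wpM2l (ltW r0)); rewrite !mulrBr mulr1.
  by rewrite [X in _ <= X - _]mulrC divfK// gt_eqF.
by rewrite sumrB rho1 -mulr_suml divff ?gt_eqF// subrr.
Qed.

(** The variational principle for the [k]-fold product distributions, whose
    relative entropy is [k] times that of one letter. *)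
Lemma avg_ln (pi rho : L -> R) (k : nat) (f : V -> R) (y : V) :
  (forall l, 0 <= pi l) -> (forall l, 0 <= rho l) -> \sum_l rho l = 1 ->
  (forall l, 0 < rho l -> 0 < pi l) ->
  0 < avg pi k (fun z => expR (f z)) y /\
  avg rho k f y <= ln (avg pi k (fun z => expR (f z)) y) +
                   k%:R * \sum_l rho l * ln (rho l / pi l).
Proof.
move=> pi0 rho0 rho1 ac; elim: k y => [|k IH] y /=.
  by rewrite expRK mul0r addr0 expR_gt0.
set KL := \sum_l rho l * ln (rho l / pi l) in IH *.
set W := fun l => avg pi k (fun z => expR (f z)) (y + x l).
have W0 l : 0 < W l by case: (IH (y + x l)).
split.
  have [l rl] := ex_weight_gt0 rho0 rho1.
  rewrite (bigD1 l)//= ltr_pwDl ?mulr_gt0 ?ac//; first exact: W0.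
  apply: sumr_ge0 => i _; rewrite mulr_ge0//; exact: ltW (W0 i).
have := gibbs_variational pi0 rho0 rho1 ac W0; rewrite -/KL.
have : \sum_l rho l * avg rho k f (y + x l) <=
    \sum_l rho l * ln (W l) + k%:R * KL.
  have E : k%:R * KL = \sum_l rho l * (k%:R * KL) by rewrite -mulr_suml rho1 mul1r.
  rewrite [X in _ + X]E -big_split/=.
  apply: ler_sum => l _; rewrite -mulrDr ler_wpM2l//.
  by have [] := IH (y + x l).
move=> H1; rewrite lerBlDr => H2; apply: le_trans H1 _.
by rewrite -natr1 mulrDl mul1r (addrC (_ * KL)) addrA lerD2r; exact: H2.
Qed.

Context (disp : measure_display) (T : measurableType disp)
        (P : {measure set T -> \bar R}).

Lemma measurable_avg (pi : L -> R) (k : nat) (F : T -> V -> R) (y : V) :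
  (forall z, measurable_fun setT (F^~ z)) ->
  measurable_fun setT (fun w => avg pi k (F w) y).
Proof.
move=> mF; elim: k y => [|k IH] y //=.
by apply: measurable_sum => l; exact: measurable_funM.
Qed.

Lemma integral_avg_le1 (pi : L -> R) (k : nat) (F : T -> V -> R) (y : V) :
  (forall l, 0 <= pi l) -> \sum_l pi l <= 1 ->
  (forall z, measurable_fun setT (F^~ z)) -> (forall w z, 0 <= F w z) ->
  (forall z, \int[P]_w (F w z)%:E <= 1)%E ->
  (\int[P]_w (avg pi k (F w) y)%:E <= 1)%E.
Proof.
move=> pi0 pi1 mF F0 F1.
have avg0 k' w z : 0 <= avg pi k' (F w) z by exact: avg_ge0.
elim: k y => [|k IH] y //=.
under eq_integral do rewrite -sumEFin.
rewrite ge0_integral_sum//; last 2 first.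
- by move=> l; apply/measurable_EFinP/measurable_funM => //; exact: measurable_avg.
- by move=> l w _; rewrite lee_fin mulr_ge0.
apply: (@le_trans _ _ (\sum_l (pi l)%:E)%E); last by rewrite sumEFin lee_fin.
apply: lee_sum => l _.
under eq_integral do rewrite EFinM.
rewrite ge0_integralZl_EFin//; last 2 first.
- by move=> w _; rewrite lee_fin.
- by apply/measurable_EFinP; exact: measurable_avg.
by rewrite -[leRHS]mule1; apply: lee_wpmul2l; rewrite ?lee_fin.
Qed.

End IteratedAverage.

(** Maurey's empirical method: a sum of [K] independent letters with mean [v]
    deviates from [v] by at most the sum of the second moments of the letters. *)
Lemma avg_sqnorm_mulmx (R : realType) (L : finType) (p q : nat) (x : L -> 'cV[R]_p)
    (rho : L -> R) (K : nat) (v : 'cV[R]_p) (M : 'M[R]_(q, p)) (a : 'cV[R]_q) :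
  \sum_l rho l = 1 -> K%:R *: \sum_l rho l *: x l = v ->
  avg x rho K (fun z => sqnorm (M *m z - a)) 0 <=
  sqnorm (M *m v - a) + K%:R * \sum_l rho l * sqnorm (M *m x l).
Proof.
move=> rho1 mv; rewrite /sqnorm.
have -> : (fun z : 'cV_p => \sum_(i < q) (M *m z - a) i 0 ^+ 2) =
    (fun z => \sum_(i < q) ((M *m z) i 0 - a i 0) ^+ 2).
  by apply/funext => z; apply: eq_bigr => i _; rewrite !mxE.
rewrite avg_sum.
under [X in _ + _ * X]eq_bigr do rewrite mulr_sumr.
rewrite exchange_big/= mulr_sumr -big_split/=; apply: ler_sum => i _.
rewrite avg_sqr//; last by move=> z z'; rewrite mulmxDr mxE.
have -> : K%:R * (\sum_l rho l * (M *m x l) i 0) = (M *m v) i 0.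
  rewrite -mv -scalemxAr mxE mulmx_sumr summxE; congr (_ * _).
  by apply: eq_bigr => l _; rewrite -scalemxAr [RHS]mxE.
rewrite mulmx0 [(0 : 'cV_q) i 0]mxE add0r [_ i 0 in leRHS]mxE [(- a) i 0]mxE.
rewrite lerD2l ler_wpM2l//.
by rewrite lerBlDr lerDl sqr_ge0.
Qed.

(** From [w ^+ 2 <= (1 + eta) * u ^+ 2 + (1 + eta^-1) * (u - w) ^+ 2], summed over
    the coordinates. *)
Lemma min_sqnorm_ge (R : realType) (k : nat) (u w : 'cV[R]_k) (eta : R) :
  0 < eta <= 1 -> sqnorm w = 1 ->
  1 - eta - 2 / eta * sqnorm (u - w) <= Num.min (sqnorm u) 1.
Proof.
move=> /andP[eta0 eta1] w1.
have e2 : 0 <= 2 / eta by rewrite divr_ge0// ltW.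
have [u1|u1] := leP 1 (sqnorm u).
  by have := mulr_ge0 e2 (sqnorm_ge0 (u - w)); lra.
have : sqnorm w <= (1 + eta) * sqnorm u + (1 + eta^-1) * sqnorm (u - w).
  rewrite /sqnorm !mulr_sumr -big_split/=; apply: ler_sum => i _.
  rewrite !mxE; set a := u i 0; set b := w i 0.
  have -> : (1 + eta) * a ^+ 2 + (1 + eta^-1) * (a - b) ^+ 2 =
      b ^+ 2 + eta * (a + eta^-1 * (a - b)) ^+ 2
       + (2 * a * (a - b)) * (1 - eta * eta^-1)
       + (a - b) ^+ 2 * eta^-1 * (1 - eta * eta^-1) by lra.
  rewrite divff ?gt_eqF// subrr !mulr0 !addr0 lerDl mulr_ge0 ?sqr_ge0//.
  exact: ltW.
rewrite w1; have := sqnorm_ge0 (u - w); move: (sqnorm (u - w)) => s s0.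
have i1 : 1 <= eta^-1 by rewrite invf_ge1.
have := mulr_ge0 (ltW eta0) (_ : 0 <= 1 - sqnorm u); rewrite subr_ge0 => /(_ (ltW u1)).
have := mulr_ge0 s0 (_ : 0 <= eta^-1 - 1); rewrite subr_ge0 => /(_ i1).
lra.
Qed.

(** The deterministic part of the PAC-Bayes argument.  The last hypothesis is the
    event on which the average over the prior is controlled; the variances [a]
    and [b] of the posterior for [B] and for [X] and its entropy [c] are what is
    lost when the bound is transferred to [v]. *)
Lemma pac_bayes_lower (R : realType) (L : finType) (n p q : nat)
    (x : L -> 'cV[R]_p) (pi rho : L -> R) (K : nat) (v : 'cV[R]_p)
    (B : 'M[R]_(q, p)) (X : 'M[R]_(n, p)) (lambda beta eta a b c t : R) :
  (forall l, 0 <= pi l) -> (forall l, 0 <= rho l) -> \sum_l rho l = 1 ->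
  (forall l, 0 < rho l -> 0 < pi l) ->
  K%:R *: \sum_l rho l *: x l = v -> sqnorm (B *m v) = 1 ->
  0 < lambda -> 0 <= beta -> 0 < eta <= 1 ->
  K%:R * \sum_l rho l * sqnorm (B *m x l) <= a ->
  K%:R * \sum_l rho l * sqnorm (X *m x l) <= n%:R * b ->
  K%:R * \sum_l rho l * ln (rho l / pi l) <= c ->
  avg x pi K (fun z => expR (- (lambda * sqnorm (X *m z)) +
     n%:R * (lambda * beta * Num.min (sqnorm (B *m z)) 1))) 0 <= expR t ->
  n%:R * (lambda * beta * (1 - eta - 2 / eta * a)) - c - t <=
  lambda * (sqnorm (X *m v) + n%:R * b).
Proof.
move=> pi0 rho0 rho1 ac mv Bv1 l0 beta0 eta01 aP bP cP tP.
set f := fun z => _ in tP.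
have [W0] := @avg_ln _ _ _ x pi rho K
  (fun z => - (lambda * sqnorm (X *m z)) +
     n%:R * (lambda * beta * Num.min (sqnorm (B *m z)) 1)) 0 pi0 rho0 rho1 ac.
have lnW : ln (avg x pi K f 0) <= t by rewrite -ler_expR lnK.
move: lnW; rewrite /f => lnW H.
have {H lnW}H : avg x rho K (fun z => - (lambda * sqnorm (X *m z)) +
     n%:R * (lambda * beta * Num.min (sqnorm (B *m z)) 1)) 0 <= t + c.
  by apply: le_trans H _; apply: lerD.
apply: (@le_trans _ _ (lambda * avg x rho K (fun z => sqnorm (X *m z)) 0)); last first.
  rewrite ler_wpM2l ?(ltW l0)//.
  have := @avg_sqnorm_mulmx _ _ _ _ x rho K v X 0 rho1 mv.
  rewrite subr0; under eq_fun do rewrite subr0.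
  by move=> /le_trans; apply; rewrite lerD2l.
move: H; rewrite avgD -[fun z => - _]/(fun z => - (lambda * sqnorm (X *m z))).
under [X in avg x rho K X 0 + _]eq_fun do rewrite -mulNr.
rewrite (avgZ x rho K (- lambda)).
have : avg x rho K (fun z => n%:R * (lambda * beta) * (1 - eta) +
     - (n%:R * (lambda * beta) * (2 / eta)) * sqnorm (B *m z - B *m v)) 0 <=
   avg x rho K (fun z => n%:R * (lambda * beta * Num.min (sqnorm (B *m z)) 1)) 0.
  apply: le_avg => // z; have := min_sqnorm_ge (B *m z) eta01 Bv1.
  have c0 : 0 <= n%:R * (lambda * beta) by rewrite mulr_ge0 ?mulr_ge0// ltW.
  by move=> /(ler_wpM2l c0); lra.
rewrite avgD avg_cst// (avgZ x rho K (- (n%:R * _ * _))).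
have := @avg_sqnorm_mulmx _ _ _ _ x rho K v B (B *m v) rho1 mv.
rewrite subrr sqnorm0 add0r.
move=> /le_trans /(_ aP) /(ler_wpM2l (_ : 0 <= n%:R * (lambda * beta) * (2 / eta))).
have e0 : 0 < eta by case/andP: eta01.
rewrite !mulr_ge0 ?invr_ge0 ?(ltW l0) ?(ltW e0)// => /(_ isT).
lra.
Qed.

(** * Decomposition of the vectors of a group into atoms *)

Section NonnegativeCombinations.
Context (R : realType) (V : lmodType R) (L : finType) (val : L -> V).

(** The gauge (atomic norm) of [x] with respect to the vectors [val a], for [a] in
    [H], is at most [N].  Total weights below [N] are allowed, so that the notion
    is monotone in [N]. *)
Definition atomic (H : pred L) (N : R) (x : V) : Prop :=
  exists w : L -> R, [/\ forall a, 0 <= w a, forall a, ~~ H a -> w a = 0,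
    \sum_a w a <= N & \sum_a w a *: val a = x].

Lemma atomic0 (H : pred L) : atomic H 0 0.
Proof.
exists (fun=> 0); split => //; first by rewrite big1.
by rewrite big1// => a _; rewrite scale0r.
Qed.

Lemma atomicD (H : pred L) (N N' : R) (x x' : V) :
  atomic H N x -> atomic H N' x' -> atomic H (N + N') (x + x').
Proof.
move=> [w [w0 wH wN wx]] [w' [w'0 w'H w'N w'x]].
exists (fun a => w a + w' a); split.
- by move=> a; rewrite addr_ge0.
- by move=> a Ha; rewrite wH// w'H// addr0.
- by rewrite big_split lerD.
- by rewrite -wx -w'x -big_split; apply: eq_bigr => a _; rewrite scalerDl.
Qed.

Lemma atomicZ (H : pred L) (c N : R) (x : V) :
  0 <= c -> atomic H N x -> atomic H (c * N) (c *: x).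
Proof.
move=> c0 [w [w0 wH wN wx]]; exists (fun a => c * w a); split.
- by move=> a; rewrite mulr_ge0.
- by move=> a Ha; rewrite wH// mulr0.
- by rewrite -mulr_sumr ler_wpM2l.
- by rewrite -wx scaler_sumr; apply: eq_bigr => a _; rewrite scalerA.
Qed.

Lemma atomic_le (H : pred L) (N N' : R) (x : V) :
  N <= N' -> atomic H N x -> atomic H N' x.
Proof.
by move=> NN' [w [w0 wH wN wx]]; exists w; split => //; exact: le_trans NN'.
Qed.

Lemma atomic1 (H : pred L) (a : L) : H a -> atomic H 1 (val a).
Proof.
move=> Ha; exists (fun b => (b == a)%:R); split => //.
- by move=> b; have [->|//] := eqVneq b a; rewrite Ha.
- rewrite (bigD1 a)//= eqxx big1 ?addr0// => b ba.
  by rewrite (negPf ba).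
- rewrite (bigD1 a)//= eqxx scale1r big1 ?addr0// => b ba.
  by rewrite (negPf ba) scale0r.
Qed.

End NonnegativeCombinations.

Section Atoms.
Context (R : realType) (p s0 : nat).
Hypothesis s0_gt0 : (0 < s0)%N.

(** Integer vectors with entries between [- 4 s0] and [4 s0], stored with the
    offset [4 s0] so as to form a finite type. *)
Definition atom := {ffun 'I_p -> 'I_(4 * s0 + 4 * s0).+1}.

Definition atom_abs (a : atom) (i : 'I_p) : nat :=
  (a i - 4 * s0) + (4 * s0 - a i).

Definition atom_vec (a : atom) : 'cV[R]_p :=
  \col_i (((a i)%:R - (4 * s0)%:R) / Num.sqrt s0%:R).

Definition is_atom (G : {set 'I_p}) (a : atom) : bool :=
  [exists S : {set 'I_p}, [&& S \subset G, (#|S| <= s0)%N &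
     [forall i, (i \notin S) ==> (atom_abs a i == 0%N)]]] &&
  (\sum_i atom_abs a i ^ 2 <= 4 * s0)%N.

Let sq0 : 0 < Num.sqrt s0%:R :> R.
Proof. by rewrite sqrtr_gt0 ltr0n. Qed.

Let sqE : Num.sqrt s0%:R ^+ 2 = s0%:R :> R.
Proof. by rewrite sqr_sqrtr. Qed.

Lemma atom_vecE (a : atom) (i : 'I_p) :
  s0%:R * atom_vec a i 0 ^+ 2 = (atom_abs a i)%:R ^+ 2.
Proof.
rewrite mxE expr_div_n sqE mulrC divfK ?gt_eqF ?ltr0n//.
rewrite /atom_abs; have [le|/ltnW le] := leqP (a i) (4 * s0).
  by rewrite (eqP le) add0n natrB// -sqrrN opprB.
by rewrite (eqP le) addn0 natrB.
Qed.

Lemma sqnorm_atom (G : {set 'I_p}) (a : atom) :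
  is_atom G a -> sqnorm (atom_vec a) <= 4.
Proof.
move=> /andP[_ a4]; rewrite -(@ler_pM2l _ s0%:R) ?ltr0n//.
rewrite /sqnorm mulr_sumr; under eq_bigr do rewrite atom_vecE -natrX.
by rewrite -natr_sum mulrC -natrM ler_nat.
Qed.

Lemma atom_supp (G : {set 'I_p}) (a : atom) : is_atom G a ->
  exists S : {set 'I_p}, [/\ S \subset G, (#|S| <= s0)%N &
     forall i, i \notin S -> atom_vec a i 0 = 0].
Proof.
move=> /andP[/existsP[S /and3P[SG Ss /forallP aS]] _]; exists S; split => // i iS.
have /eqP a0 := implyP (aS i) iS.
have := atom_vecE a i; rewrite a0 expr0n/= => /eqP.
by rewrite mulf_eq0 pnatr_eq0 gtn_eqF//= sqrf_eq0 => /eqP.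
Qed.

Lemma atomic_int (G S : {set 'I_p}) (z : 'I_p -> int) :
  S \subset G -> (#|S| <= s0)%N -> (forall i, i \notin S -> z i = 0) ->
  \sum_i (z i)%:~R ^+ 2 <= (4 * s0)%:R :> R ->
  atomic atom_vec (is_atom G) 1 (\col_i ((z i)%:~R / Num.sqrt s0%:R)).
Proof.
move=> SG Ss zS z4.
have z4N : (\sum_i `|z i| ^ 2 <= 4 * s0)%N.
  rewrite -(ler_nat R) natr_sum; apply: le_trans z4; apply: ler_sum => i _.
  by rewrite natrX natr_absz intr_norm real_normK ?num_real.
have zi i : (`|z i| <= 4 * s0)%N.
  apply: leq_trans z4N; rewrite (bigD1 i)//=; apply: leq_trans (leq_addr _ _).
  by case: `|z i|%N => // k; rewrite leq_pmulr.
pose a : atom := [ffun i => inord `|z i + (4 * s0)%:Z|].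
have aE i : (a i : nat)%:Z = z i + (4 * s0)%:Z.
  rewrite ffunE inordK; first by have := zi i; lia.
  by have := zi i; lia.
have absE i : atom_abs a i = `|z i|%N.
  by rewrite /atom_abs; have := aE i; have := zi i; lia.
have <- : atom_vec a = \col_i ((z i)%:~R / Num.sqrt s0%:R).
  apply/matrixP => i j; rewrite !mxE; congr (_ / _).
  by rewrite (_ : z i = (a i)%:Z - (4 * s0)%:Z) ?rmorphB// aE addrK.
apply: atomic1; rewrite /is_atom; apply/andP; split.
  apply/existsP; exists S; rewrite SG Ss/=; apply/forallP => i.
  by apply/implyP => iS; rewrite absE zS.
by under eq_bigr do rewrite absE.
Qed.

(** Rounding: a vector is a convex combination of the two vectors obtained by
    moving one of its coordinates to the neighbouring integers.  The list [s]
    contains the coordinates which remain to be rounded. *)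
Lemma atomic_round (G S : {set 'I_p}) (lo : 'I_p -> int) (s : seq 'I_p)
    (y : 'I_p -> R) :
  S \subset G -> (#|S| <= s0)%N ->
  (forall z : 'I_p -> int, (forall i, i \notin S -> z i = 0) ->
     (forall i, i \in S -> z i = lo i \/ z i = lo i + 1) ->
     \sum_i (z i)%:~R ^+ 2 <= (4 * s0)%:R :> R) ->
  (forall i, i \in S -> (lo i)%:~R <= y i <= (lo i + 1)%:~R) ->
  (forall i, i \notin S -> y i = 0) ->
  (forall i, i \in S -> i \notin s -> y i = (lo i)%:~R \/ y i = (lo i + 1)%:~R) ->
  atomic atom_vec (is_atom G) 1 (\col_i (y i / Num.sqrt s0%:R)).
Proof.
move=> SG Ss z4; elim: s y => [|j s IH] y ylo yS ys.
  have /choice[z zP] i : exists k : int, y i = k%:~R /\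
      (i \notin S -> k = 0) /\ (i \in S -> k = lo i \/ k = lo i + 1).
    have [iS|iS] := boolP (i \in S); last by exists 0; rewrite yS.
    by have [->|->] := ys i iS isT; [exists (lo i)|exists (lo i + 1)];
      split => //; split => // _; [left|right].
  have -> : \col_i (y i / Num.sqrt s0%:R) =
      \col_i ((z i)%:~R / Num.sqrt s0%:R) :> 'cV[R]_p.
    by apply/matrixP => i k; rewrite !mxE (zP i).1.
  apply: (atomic_int SG Ss) => [i|]; first by apply (zP i).2.1.
  by apply: z4 => i; [apply (zP i).2.1|apply (zP i).2.2].
have [jS|jS] := boolP (j \in S); last first.
  apply: IH => // i iS iNs; apply: ys => //; rewrite inE negb_or iNs andbT.
  by apply: contraNneq jS => <-.
pose f := y j - (lo j)%:~R.
have /andP[f0 f1] : 0 <= f <= 1.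
  by have /andP[] := ylo j jS; rewrite rmorphD/= /f; lra.
pose yy (b : int) i := if i == j then (lo j + b)%:~R else y i.
have H (b : int) : b = 0 \/ b = 1 ->
    atomic atom_vec (is_atom G) 1 (\col_i (yy b i / Num.sqrt s0%:R)).
  move=> b01; apply: IH.
  - move=> i iS; rewrite /yy; case: eqP => [->|_]; last exact: ylo.
    by case: b01 => ->; rewrite !rmorphD/=; lra.
  - move=> i iS; rewrite /yy; case: eqP => [ij|_]; last exact: yS.
    by rewrite ij jS in iS.
  - move=> i iS iNs; rewrite /yy; case: eqP => [->|/eqP ij].
      by case: b01 => ->; rewrite ?addr0; [left|right].
    by apply: ys => //; rewrite inE negb_or ij.
have := atomicD (atomicZ (_ : 0 <= 1 - f) (H 0 (or_introl erefl)))
             (atomicZ f0 (H 1 (or_intror erefl))).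
rewrite subr_ge0 => /(_ f1); rewrite !mulr1 subrK.
congr atomic; apply/matrixP => i k; rewrite !mxE /yy.
case: eqP => [->|_]; rewrite ?rmorphD/= /f; lra.
Qed.

(** After scaling to norm [sqrt s0] the coordinates are rounded to integers.
    Rounding changes at most [s0] coordinates, each by at most 1, so that the
    squared norm stays below [2 s0 + 2 s0]. *)
Lemma atomic_sparse (G S : {set 'I_p}) (x : 'cV[R]_p) :
  S \subset G -> (#|S| <= s0)%N -> (forall i, i \notin S -> x i 0 = 0) ->
  atomic atom_vec (is_atom G) (l2norm x) x.
Proof.
move=> SG Ss xS.
have [n0|n0] := eqVneq (l2norm x) 0.
  by rewrite n0 (l2norm_eq0 n0); exact: atomic0.
have {}n0 : 0 < l2norm x by rewrite lt_neqAle eq_sym n0 sqrtr_ge0.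
pose y i := Num.sqrt s0%:R * (x i 0 / l2norm x).
have xE : x = l2norm x *: \col_i (y i / Num.sqrt s0%:R).
  apply/matrixP => i j; rewrite !mxE ord1 /y.
  by rewrite (mulrC (Num.sqrt s0%:R)) mulfK ?gt_eqF// mulrC divfK ?gt_eqF.
rewrite [X in atomic _ _ _ X]xE -[X in atomic _ _ X _]mulr1.
apply: atomicZ; first exact: ltW.
apply: (@atomic_round G S (fun i => Num.floor (y i)) (enum S)) => //.
- move=> z zS zlo.
  have zb i : (z i)%:~R ^+ 2 <= 2 * y i ^+ 2 + 2 * (i \in S)%:R :> R.
    have [iS|iS] := boolP (i \in S); last first.
      by rewrite zS// /y xS// mul0r mulr0 expr0n/= mulr0 addr0.
    have sq_near (u v : R) : -1 <= u - v <= 1 -> v ^+ 2 <= 2 * u ^+ 2 + 2 * 1.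
      by move=> /andP[? ?]; have := sqr_ge0 (2 * u - v); nra.
    apply: sq_near; have /andP[] := floor_itv (y i); rewrite !rmorphD/=.
    by case: (zlo i iS) => ->; rewrite ?rmorphD/=; lra.
  apply: le_trans (ler_sum _ (fun i _ => zb i)) _.
  rewrite big_split/= -!mulr_sumr.
  have -> : \sum_i y i ^+ 2 = s0%:R.
    under eq_bigr do rewrite exprMn expr_div_n sqE.
    by rewrite -mulr_sumr -mulr_suml -/(sqnorm x) -sqr_l2norm divff ?mulr1// gt_eqF ?exprn_gt0.
  have : \sum_i (i \in S)%:R <= s0%:R :> R.
    rewrite -natr_sum ler_nat; apply: leq_trans Ss; rewrite -sum1_card.
    by rewrite [leqRHS]big_mkcond; apply: leq_sum => i _; case: (i \in S).
  by rewrite natrM; lra.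
- move=> i iS; have /andP[-> /ltW] := floor_itv (y i).
  by [].
- by move=> i iS; rewrite /y xS// mul0r mulr0.
- by move=> i iS; rewrite mem_enum iS.
Qed.

End Atoms.

Section GroupGauge.
Context (R : realType) (p s0 : nat).
Hypothesis s0_gt0 : (0 < s0)%N.

Let sq0 : 0 < Num.sqrt s0%:R :> R.
Proof. by rewrite sqrtr_gt0 ltr0n. Qed.

Let sqE : Num.sqrt s0%:R ^+ 2 = s0%:R :> R.
Proof. by rewrite sqr_sqrtr. Qed.

Definition restr (S : {set 'I_p}) (x : 'cV[R]_p) : 'cV[R]_p :=
  \col_i if i \in S then x i 0 else 0.

Lemma sqnorm_restr (S : {set 'I_p}) (x : 'cV[R]_p) :
  sqnorm (restr S x) = \sum_(i in S) x i 0 ^+ 2.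
Proof.
rewrite [RHS]big_mkcond; apply: eq_bigr => i _; rewrite mxE.
by case: ifP; rewrite // expr0n.
Qed.

Lemma top_subset (S : {set 'I_p}) (h : 'I_p -> R) (k : nat) : (k <= #|S|)%N ->
  exists J : {set 'I_p}, [/\ J \subset S, #|J| = k &
    forall i j, i \in J -> j \in S :\: J -> h j <= h i].
Proof.
elim: k => [|k IH] kS.
  by exists finset.set0; split; rewrite ?finset.sub0set ?cards0// => i j; rewrite inE.
have [J [JS Jk Jh]] := IH (ltnW kS).
have /finset.set0Pn[i0 i0SJ] : S :\: J != finset.set0.
  by rewrite -card_gt0 cardsD (finset.setIidPr JS) Jk subn_gt0.
have [i iSJ imax] := @arg_maxP _ _ _ i0 (mem (S :\: J)) h i0SJ.
have /setDP[iS iJ] : i \in S :\: J by exact: iSJ.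
exists (i |: J); split.
- by rewrite finset.subUset finset.sub1set iS.
- by rewrite cardsU1 iJ Jk.
move=> a b; rewrite in_setU1 => /orP[/eqP->|aJ]; rewrite !inE negb_or -andbA.
  by move=> /and3P[_ bJ bS]; apply: imax; apply/setDP.
by move=> /and3P[_ bJ bS]; apply: Jh => //; apply/setDP.
Qed.

(** The sorted blocks argument: split off the [s0] largest entries.  The others
    are bounded by the mean of these, which turns the term in [M] for the
    remaining entries into a part of the l1-term. *)
Lemma atomic_flat (G S : {set 'I_p}) (x : 'cV[R]_p) (M : R) :
  S \subset G -> (forall i, i \notin S -> x i 0 = 0) ->
  0 <= M -> (forall i, `|x i 0| <= M) ->
  atomic (@atom_vec R p s0) (is_atom G)
    (Num.sqrt s0%:R * M + (\sum_i `|x i 0|) / Num.sqrt s0%:R) x.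
Proof.
have [k] := ubnP #|S|; elim: k S x M => // k IH S x M Sk SG xS M0 xM.
have l2M (J : {set 'I_p}) : J \subset S -> (#|J| <= s0)%N ->
    l2norm (restr J x) <= Num.sqrt s0%:R * M.
  move=> JS Js; rewrite -(@ler_pXn2r _ 2) ?nnegrE ?sqrtr_ge0 ?mulr_ge0 ?(ltW sq0)//.
  rewrite sqr_l2norm sqnorm_restr exprMn sqE.
  apply: (@le_trans _ _ (\sum_(i in J) M ^+ 2)).
    apply: ler_sum => i _; rewrite -real_normK ?num_real//.
    by rewrite lerXn2r ?nnegrE.
  by rewrite sumr_const -[leLHS]mulr_natl ler_wpM2r ?sqr_ge0// ler_nat.
have l10 (z : 'cV[R]_p) : 0 <= (\sum_i `|z i 0|) / Num.sqrt s0%:R.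
  by rewrite divr_ge0 ?sumr_ge0// ltW.
have [Ss|Ss] := leqP #|S| s0.
  apply: atomic_le (atomic_sparse s0_gt0 SG Ss xS).
  have := l2M _ (subxx S) Ss; have := l10 x.
  rewrite (_ : restr S x = x); first by lra.
  apply/matrixP => i j; rewrite mxE ord1.
  by case: (boolP (i \in S)) => // /xS ->.
have [J [JS Js Jtop]] := top_subset (fun i => `|x i 0|) (ltnW Ss).
have xE : x = restr J x + restr (S :\: J) x.
  apply/matrixP => i j; rewrite !mxE ord1 !inE.
  case: (boolP (i \in J)) => /=; rewrite ?addr0// add0r.
  by case: (boolP (i \in S)) => // /xS ->.
pose M' := (\sum_(i in J) `|x i 0|) / s0%:R.
have JsG : J \subset G by exact: fintype.subset_trans SG.
have R1 := @atomic_sparse R _ _ s0_gt0 G J (restr J x) JsG.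
rewrite Js leqnn in R1; have {}R1 := R1 isT.
have {}R1 : atomic (@atom_vec R p s0) (is_atom G) (Num.sqrt s0%:R * M) (restr J x).
  apply: atomic_le (l2M _ JS _) (R1 _); first by rewrite Js.
  by move=> i iJ; rewrite mxE (negPf iJ).
have R2 : atomic (@atom_vec R p s0) (is_atom G) (Num.sqrt s0%:R * M' +
    (\sum_i `|restr (S :\: J) x i 0|) / Num.sqrt s0%:R) (restr (S :\: J) x).
  apply: (IH (S :\: J)).
  - by rewrite cardsD (finset.setIidPr JS) Js; lia.
  - by apply: fintype.subset_trans SG; exact: finset.subsetDl.
  - by move=> i iS; rewrite mxE (negPf iS).
  - by rewrite divr_ge0 ?sumr_ge0.
  - move=> i; rewrite mxE; case: ifPn => iS; last first.
      by rewrite normr0 divr_ge0 ?sumr_ge0.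
    rewrite /M' ler_pdivlMr ?ltr0n// mulr_natr -Js -sumr_const.
    by apply: ler_sum => j jJ; exact: Jtop.
rewrite [X in atomic _ _ _ X]xE; apply: atomic_le (atomicD R1 R2).
rewrite lerD2l (_ : Num.sqrt s0%:R * M' =
  (\sum_(i in J) `|x i 0|) / Num.sqrt s0%:R); last first.
  rewrite /M' mulrCA; congr (_ * _).
  have -> : s0%:R^-1 = (Num.sqrt s0%:R)^-1 * (Num.sqrt s0%:R)^-1 :> R.
    by rewrite -invfM -expr2 sqE.
  by rewrite mulrA mulfV ?mul1r// gt_eqF.
rewrite -mulrDl ler_wpM2r ?invr_ge0 ?(ltW sq0)//.
rewrite big_mkcond -big_split/=; apply: ler_sum => i _; rewrite mxE !inE.
by case: (i \in J) => /=; rewrite ?normr0 ?addr0// add0r; case: ifP; rewrite ?normr0.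
Qed.

(** At most [s0] entries exceed [l2norm v / sqrt s0], and these form a sparse
    vector; the others are handled by [atomic_flat]. *)
Lemma atomic_group (G : {set 'I_p}) (v : 'cV[R]_p) :
  atomic (@atom_vec R p s0) (is_atom G)
    (2 * l2norm_on G v + (\sum_(i in G) `|v i 0|) / Num.sqrt s0%:R)
    (restr G v).
Proof.
set x := restr G v; set N := l2norm_on G v.
have NE : l2norm x = N by rewrite /l2norm -/(sqnorm x) sqnorm_restr.
have N0 : 0 <= N by rewrite sqrtr_ge0.
pose J := [set i | N < Num.sqrt s0%:R * `|x i 0|]%SET.
have JG : J \subset G.
  apply/fintype.subsetP => i; rewrite inE mxE; case: ifP => // _.
  by rewrite normr0 mulr0 ltNge N0.
have Js : (#|J| <= s0)%N.
  have [//|Js] := leqP #|J| s0.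
  have /card_gt0P[i0 i0J] : (0 < #|J|)%N by exact: leq_ltn_trans Js.
  have lt1 i : i \in J -> N ^+ 2 < s0%:R * x i 0 ^+ 2.
    rewrite inE => iJ; rewrite -sqE -[x i 0 ^+ 2]real_normK ?num_real// -exprMn.
    by rewrite ltrXn2r ?nnegrE ?mulr_ge0// ltW.
  have : #|J|%:R * N ^+ 2 < s0%:R * N ^+ 2.
    rewrite mulr_natl -sumr_const.
    apply: (@lt_le_trans _ _ (\sum_(i in J) s0%:R * x i 0 ^+ 2)).
      rewrite (bigD1 i0)//= [ltRHS](bigD1 i0)//=; apply: ltr_leD; first exact: lt1.
      by apply: ler_sum => i /andP[iJ _]; apply: ltW; exact: lt1.
    rewrite -mulr_sumr ler_wpM2l// -NE sqr_l2norm /sqnorm.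
    rewrite [leRHS](bigID (mem J))/= lerDl sumr_ge0// => i _; exact: sqr_ge0.
  by rewrite ltNge ler_wpM2r ?sqr_ge0// ler_nat ltnW.
have xE : x = restr J x + restr (G :\: J) x.
  apply/matrixP => i j; rewrite !mxE finset.in_setD.
  by case: (i \in J); case: (i \in G); rewrite /= ?addr0 ?add0r.
have R1 : atomic (@atom_vec R p s0) (is_atom G) N (restr J x).
  apply: atomic_le (atomic_sparse s0_gt0 JG Js _); last first.
    by move=> i iJ; rewrite mxE (negPf iJ).
  rewrite -NE /l2norm ler_wsqrtr// -!/(sqnorm _) sqnorm_restr /sqnorm.
  rewrite [leRHS](bigID (mem J))/= lerDl sumr_ge0// => i _; exact: sqr_ge0.
have R2 := @atomic_flat G (G :\: J) (restr (G :\: J) x) (N / Num.sqrt s0%:R).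
have {}R2 : atomic (@atom_vec R p s0) (is_atom G)
   (N + (\sum_(i in G) `|v i 0|) / Num.sqrt s0%:R) (restr (G :\: J) x).
  apply: atomic_le (R2 _ _ _ _).
  - rewrite mulrC divfK ?gt_eqF// lerD2l ler_wpM2r ?invr_ge0 ?(ltW sq0)//.
    rewrite [leRHS]big_mkcond; apply: ler_sum => i _; rewrite !mxE finset.in_setD.
    by case: (i \in J) => /=; case: (i \in G); rewrite ?normr0.
  - exact: finset.subsetDl.
  - by move=> i iS; rewrite mxE (negPf iS).
  - by rewrite divr_ge0// ltW.
  - move=> i; rewrite mxE; case: ifPn => [|_]; last first.
      by rewrite normr0 divr_ge0// ltW.
    rewrite finset.in_setD inE -leNgt => /andP[iN _].
    by rewrite ler_pdivlMr// mulrC.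
rewrite [X in atomic _ _ _ X]xE; apply: atomic_le (atomicD R1 R2); lra.
Qed.

End GroupGauge.

Lemma sum_expr_le (R : realType) (theta : R) (n : nat) : 0 <= theta <= 1 / 2 ->
  \sum_(0 <= k < n) theta ^+ k.+1 <= 2 * theta.
Proof.
move=> /andP[t0 t1]; elim: n => [|n IH]; first by rewrite big_geq// mulr_ge0.
rewrite big_nat_recl// expr1; under eq_bigr do rewrite exprS.
by rewrite -mulr_sumr; nra.
Qed.

(** Generating function bound: give a vector [z] the weight [th ^+ sum_i |z_i|] with
    [th = s0 / (2 d)].  For an atom the exponent is at most [4 s0], since integers
    satisfy [|z_i| <= z_i^2]; the total weight factors over the [d] coordinates
    and is at most [(1 + 4 th) ^+ d <= expR (2 s0)]. *)
Lemma card_atoms (R : realType) (p s0 d : nat) (G : {set 'I_p}) :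
  (0 < s0)%N -> (s0 <= d)%N -> #|G| = d ->
  ln (#|[pred a : atom p s0 | is_atom G a]|%:R) <=
    4 * s0%:R * ln (2 * expR 1 * d%:R / s0%:R) :> R.
Proof.
move=> s0_gt0 s0d Gd.
have d0 : (0 < d)%N by exact: leq_trans s0d.
have s0R : 0 < s0%:R :> R by rewrite ltr0n.
have dR : 0 < d%:R :> R by rewrite ltr0n.
pose th : R := s0%:R / (2 * d%:R).
have th0 : 0 < th by rewrite divr_gt0// mulr_gt0.
have th1 : th <= 1 / 2.
  have : s0%:R <= d%:R :> R by rewrite ler_nat.
  by rewrite /th ler_pdivrMr ?mulr_gt0//; lra.
pose B := (4 * s0)%N.
pose om (i : 'I_p) (k : 'I_(4 * s0 + 4 * s0).+1) : R :=
  if i \in G then th ^+ ((k - B) + (B - k))%N else ((k : nat) == B)%:R.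
have om0 i k : 0 <= om i k.
  by rewrite /om; case: ifP => // _; rewrite exprn_ge0// ltW.
have sum_om i : i \in G -> \sum_k om i k <= 1 + 4 * th.
  move=> iG; under eq_bigr do rewrite /om iG.
  rewrite -(big_mkord xpredT (fun k => th ^+ ((k - B) + (B - k))%N)).
  rewrite (@big_cat_nat _ _ _ B)//=; last by rewrite /B; lia.
  rewrite [X in _ + X](@big_ltn _ _ _ B)//; last by rewrite /B; lia.
  rewrite subnn expr0.
  have H1 : \sum_(0 <= k < B) th ^+ ((k - B) + (B - k))%N <= 2 * th.
    rewrite big_nat_rev/= add0n.
    apply: le_trans (@sum_expr_le R th B _); last by rewrite (ltW th0) th1.
    rewrite big_nat [leRHS]big_nat; apply: ler_sum => k /andP[_ kB].
    by rewrite (_ : (_ + _)%N = k.+1)//; lia.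
  have H2 : \sum_(B.+1 <= k < (B + B).+1) th ^+ ((k - B) + (B - k))%N <= 2 * th.
    rewrite -[B.+1]add0n big_addn.
    apply: le_trans (@sum_expr_le R th ((B + B).+1 - B.+1) _); last by rewrite (ltW th0) th1.
    rewrite big_nat [leRHS]big_nat; apply: ler_sum => k /andP[_ kB].
    by rewrite (_ : (_ + _)%N = k.+1)//; lia.
  by move: H1 H2; rewrite /B; lra.
have sum_om1 i : i \notin G -> \sum_k om i k <= 1.
  move=> iG; under eq_bigr do rewrite /om (negPf iG).
  have Bk : (B < (4 * s0 + 4 * s0).+1)%N by rewrite /B; lia.
  rewrite (bigD1 (Ordinal Bk))//= eqxx big1 ?addr0// => k kB.
  by case: eqP => // kB'; case/eqP: kB; exact/val_inj.
set C := #|_|.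
have C_le : C%:R * th ^+ B <= (1 + 4 * th) ^+ d.
  apply: (@le_trans _ _ (\sum_(a : atom p s0) \prod_i om i (a i))); last first.
    rewrite -bigA_distr_bigA/= (bigID (mem G))/= -[leRHS]mulr1.
    have sum0 i : 0 <= \sum_k om i k by rewrite sumr_ge0.
    apply: ler_pM; rewrite ?prodr_ge0//.
      rewrite -Gd -prodr_const; apply: ler_prod => i iG.
      by rewrite sum0 sum_om.
    rewrite -[leRHS](@big1_eq R 1 *%R _ (index_enum 'I_p) (fun i => i \notin G)).
    by apply: ler_prod => i iG; rewrite sum0 sum_om1.
  rewrite mulr_natl -sumr_const big_mkcond; apply: ler_sum => a _.
  case: ifP; last by rewrite prodr_ge0.
  rewrite inE => /andP[/existsP[S /and3P[SG _ /forallP aS]] a4].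
  have aG i : i \notin G -> om i (a i) = 1.
    move=> iG; rewrite /om (negPf iG); have := implyP (aS i).
    move=> /(_ (contra (fintype.subsetP SG i) iG)); rewrite /atom_abs => /eqP a0.
    suff -> : nat_of_ord (a i) = B by rewrite eqxx.
    by rewrite /B; move: a0; move: (nat_of_ord (a i)) => k; clear; lia.
  apply: (@le_trans _ _ (\prod_i th ^+ atom_abs a i)).
    rewrite prodrXr; apply: ler_wiXn2l; [exact: ltW|lra|].
    apply: leq_trans a4; apply: leq_sum => i _.
    by case: (atom_abs a i) => // k; rewrite leq_pmulr.
  apply: ler_prod => i _; rewrite exprn_ge0 ?(ltW th0)//=.
  have [iG|iG] := boolP (i \in G); first by rewrite /om iG.
  by rewrite aG// exprn_ile1 ?(ltW th0)//; lra.
have L0 : 0 <= ln (d%:R / s0%:R) :> R.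
  by rewrite ln_ge0// ler_pdivlMr// mul1r ler_nat.
have LE : ln (2 * expR 1 * d%:R / s0%:R) = ln (2 * d%:R / s0%:R) + 1 :> R.
  rewrite (_ : 2 * expR 1 * d%:R / s0%:R = 2 * d%:R / s0%:R * expR 1); last by lra.
  by rewrite lnM ?posrE ?expR_gt0 ?divr_gt0 ?mulr_gt0// expRK.
have thE : ln th = - ln (2 * d%:R / s0%:R).
  by rewrite -lnV ?posrE ?divr_gt0 ?mulr_gt0// invf_div.
have L20 : 0 <= ln (2 * d%:R / s0%:R) :> R.
  by rewrite -mulrA lnM ?posrE ?divr_gt0// addr_ge0// ln_ge0//; lra.
have [C0|C0] := posnP C.
  by rewrite C0 ln0// mulr_ge0// LE addr_ge0.
have CR : 0 < C%:R :> R by rewrite ltr0n.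
have : ln (C%:R * th ^+ B) <= 2 * s0%:R.
  apply: (@le_trans _ _ (ln ((1 + 4 * th) ^+ d))).
    by rewrite ler_ln ?posrE ?mulr_gt0 ?exprn_gt0//; lra.
  rewrite lnXn; last by lra.
  rewrite -[leLHS]mulr_natl.
  apply: (@le_trans _ _ (d%:R * (4 * th))).
    by rewrite ler_wpM2l//; have := @le1_ln R (1 + 4 * th); lra.
  have : th * (2 * d%:R) = s0%:R by rewrite divfK// gt_eqF// mulr_gt0.
  lra.
rewrite lnM ?posrE ?exprn_gt0// lnXn// thE LE -[_ *+ B]mulr_natl /B natrM; lra.
Qed.

(** * Rearrangement and the weights *)

Section Rearrangement.
Variable R : realType.

Fixpoint wsum (a : nat -> R) (s : seq R) : R :=
  if s is x :: s' then a 0%N * x + wsum (fun i => a i.+1) s' else 0.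

Lemma wsumE (a : nat -> R) (s : seq R) :
  wsum a s = \sum_(0 <= i < size s) a i * nth 0 s i.
Proof.
elim: s a => [|x s IH] a /=; first by rewrite big_geq.
by rewrite big_nat_recl//= IH.
Qed.

Lemma wsum_map (T : eqType) (x0 : T) (a : nat -> R) (h : T -> R) (s : seq T) :
  uniq s -> wsum a [seq h j | j <- s] = \sum_(j <- s) a (index j s) * h j.
Proof.
move=> us; rewrite wsumE size_map (big_nth x0) !big_mkord.
by apply: eq_bigr => i _; rewrite index_uniq// (nth_map x0).
Qed.

Definition nonincr (a : nat -> R) := forall i j, (i <= j)%N -> a j <= a i.

Lemma wsum_front (a : nat -> R) (s1 s2 : seq R) (y : R) :
  nonincr a -> (forall x, x \in s1 -> x <= y) ->
  wsum a (s1 ++ y :: s2) <= wsum a (y :: s1 ++ s2).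
Proof.
elim: s1 a => [//|x s1 IH] a na s1y /=.
have na' : nonincr (fun i => a i.+1) by move=> i j ij; exact: na.
have s1y' z : z \in s1 -> z <= y by move=> zs; rewrite s1y// inE zs orbT.
have := IH _ na' s1y'; rewrite /=.
have := s1y x (mem_head _ _); have := na 0%N 1%N isT; nra.
Qed.

(** The rearrangement inequality.  The maximum of [s] is moved to the front,
    where the weight is largest, and the rest is treated by induction. *)
Lemma wsum_sorted (a : nat -> R) (s t : seq R) :
  nonincr a -> sorted >=%R t -> perm_eq s t -> wsum a s <= wsum a t.
Proof.
elim: t s a => [|y t IH] s a na st; first by move=> /perm_nilP->.
move=> pst; have ys : y \in s by rewrite (perm_mem pst) mem_head.
case/splitPr: ys pst => s1 s2 pst.
have {pst} pst : perm_eq (y :: s1 ++ s2) (y :: t).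
  by apply: perm_trans pst; rewrite -cat1s perm_catCA.
have na' : nonincr (fun i => a i.+1) by move=> i j ij; exact: na.
have s1y x : x \in s1 -> x <= y.
  move=> xs1; have : x \in t by move: pst; rewrite perm_cons => /perm_mem <-; rewrite mem_cat xs1.
  have tr : transitive (>=%R : rel R) by move=> u v w uv vw; exact: le_trans vw uv.
  by move: st => /= /(order_path_min tr)/allP/[apply].
apply: (le_trans (wsum_front s2 na s1y)).
rewrite /= lerD2l; apply: IH => //; first exact: path_sorted st.
by rewrite -(perm_cons y).
Qed.

Lemma sum_nth_largest (a : nat -> R) (l s : seq R) (n : nat) :
  nonincr (fun i => a i.+1) -> size l = n -> perm_eq s l ->
  wsum (fun i => a i.+1) s <= \sum_(1 <= i < n.+1) a i * nth_largest l i.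
Proof.
move=> na ln sl; rewrite big_add1/=.
have -> : \sum_(0 <= i < n) a i.+1 * nth_largest l i.+1 =
    wsum (fun i => a i.+1) (sort >=%R l) by rewrite wsumE size_sort ln.
apply: wsum_sorted => //; last by rewrite perm_sym perm_sort perm_sym.
by apply: sort_sorted => x y; exact: le_total.
Qed.

End Rearrangement.

Section Weights.
Context (R : realType) (sigma : R) (m d s0 : nat).
Hypotheses (sigma_gt0 : 0 < sigma) (m_gt0 : (0 < m)%N)
           (s0_gt0 : (0 < s0)%N) (s0d : (s0 <= d)%N).

Let mR : 0 < m%:R :> R. Proof. by rewrite ltr0n. Qed.
Let s0R : 0 < s0%:R :> R. Proof. by rewrite ltr0n. Qed.
Let d_gt0 : (0 < d)%N. Proof. exact: leq_trans s0d. Qed.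
Let dR : 0 < d%:R :> R. Proof. by rewrite ltr0n. Qed.
Let e0 : 0 < expR 1 :> R. Proof. exact: expR_gt0. Qed.

Let L : R := ln (2 * expR 1 * d%:R / s0%:R).
Let M (j : nat) : R := ln (4 * expR 1 * m%:R / j%:R).

Lemma logd_ge1 : 1 <= L.
Proof.
rewrite -[leLHS](@expRK R) ler_ln ?posrE ?divr_gt0 ?mulr_gt0//.
rewrite ler_pdivlMr//; have : s0%:R <= d%:R :> R by rewrite ler_nat.
by move=> /(ler_wpM2l (ltW e0)); have := mulr_gt0 e0 dR; lra.
Qed.

Lemma logm_ge1 (j : nat) : (0 < j <= m)%N -> 1 <= M j.
Proof.
move=> /andP[j0 jm]; have jR : 0 < j%:R :> R by rewrite ltr0n.
rewrite -[leLHS](@expRK R) ler_ln ?posrE ?divr_gt0 ?mulr_gt0//.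
rewrite ler_pdivlMr//; have : j%:R <= m%:R :> R by rewrite ler_nat.
by move=> /(ler_wpM2l (ltW e0)); have := mulr_gt0 e0 mR; lra.
Qed.

Lemma logm_le (i j : nat) : (0 < i)%N -> (i <= j)%N -> M j <= M i.
Proof.
move=> i0 ij; have j0 : (0 < j)%N by exact: leq_trans ij.
rewrite ler_ln ?posrE ?divr_gt0 ?mulr_gt0 ?ltr0n//.
by rewrite ler_wpM2l ?mulr_ge0 ?(ltW e0)// lef_pV2 ?posrE ?ltr0n// ler_nat.
Qed.

Lemma lam_le (i j : nat) : (0 < i)%N -> (i <= j)%N ->
  lam sigma m d s0 j <= lam sigma m d s0 i.
Proof.
move=> i0 ij; rewrite /lam ler_wpM2l ?(ltW sigma_gt0)// ler_wsqrtr// lerD2l.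
by rewrite ler_wpM2l ?divr_ge0//; exact: logm_le.
Qed.

Lemma lam_ge0 (j : nat) : 0 <= lam sigma m d s0 j.
Proof. by rewrite mulr_ge0 ?sqrtr_ge0// ltW. Qed.

Lemma sqr_lam (j : nat) : (0 < j <= m)%N ->
  lam sigma m d s0 j ^+ 2 = sigma ^+ 2 * (L + 2 / s0%:R * M j).
Proof.
move=> jm; rewrite exprMn sqr_sqrtr// addr_ge0//.
  by have := logd_ge1; rewrite /L; lra.
by rewrite mulr_ge0 ?divr_ge0//; have := logm_ge1 jm; rewrite /M; lra.
Qed.

Lemma ceil_divnS (i : nat) : ceil_divn i.+1 s0 = (i %/ s0).+1.
Proof. by rewrite /ceil_divn addSn/= addnC divnDl ?dvdnn// divnn s0_gt0. Qed.

Lemma tlamS (i : nat) : tlam sigma m d s0 i.+1 =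
  lam sigma m d s0 (minn (i %/ s0).+1 m).
Proof.
rewrite /tlam ceil_divnS; have [lt|ge] := ltnP i (s0 * m).
  by rewrite (minn_idPl _)// ltn_divLR// mulnC.
by rewrite (minn_idPr _)// ltnW// ltnS leq_divRL// mulnC.
Qed.

Lemma nonincr_tlam : nonincr (fun i => tlam sigma m d s0 i.+1).
Proof.
move=> i j ij; rewrite !tlamS; apply: lam_le; first by rewrite leq_min m_gt0.
by rewrite leq_min geq_minr andbT geq_min ltnS leq_div2r.
Qed.

Lemma nonincr_lam : nonincr (fun i => lam sigma m d s0 i.+1).
Proof. by move=> i j ij; exact: lam_le. Qed.

(** Listing the entries group by group puts those of the group of rank [r] among
    the first [r d], so this compares the weight of a group with the weights of
    its entries.  The ranks [r] and [i / s0] differ by a factor at most [2 d / s0],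
    whose logarithm is already part of the weights. *)
Lemma lam_le_tlam (r i : nat) : (0 < r <= m)%N -> (i < r * d)%N ->
  lam sigma m d s0 r <= 2 * tlam sigma m d s0 i.+1.
Proof.
move=> rm ird; rewrite tlamS; set q := minn _ _.
have qm : (0 < q <= m)%N by rewrite leq_min m_gt0 geq_minr.
have q_le : (q * s0 <= 2 * (r * d))%N.
  have : (q <= (i %/ s0).+1)%N by exact: geq_minl.
  have := leq_trunc_div i s0; have : (s0 <= r * d)%N.
    by apply: leq_trans s0d _; rewrite leq_pmull//; case/andP: rm.
  by nia.
have [/andP[r0 _] /andP[q0 _]] := (rm, qm).
have rR : 0 < r%:R :> R by rewrite ltr0n.
have qR : 0 < q%:R :> R by rewrite ltr0n.
have MM : M r <= M q + L.
  rewrite /M /L -lnM ?posrE ?divr_gt0 ?mulr_gt0//.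
  rewrite ler_ln ?posrE ?mulr_gt0 ?invr_gt0// ler_pdivrMr//.
  pose F : R := 2 * (r%:R * d%:R) / (q%:R * s0%:R).
  have F1 : 1 <= F.
    by rewrite ler_pdivlMr ?mulr_gt0// mul1r -!natrM ler_nat.
  rewrite [leRHS](_ : _ = 4 * expR 1 * m%:R * (F * expR 1)); last first.
    by rewrite /F invfM; lra.
  have e1 : 1 <= expR 1 :> R by rewrite -[leLHS]expR0 ler_expR.
  by rewrite ler_peMr ?mulr_ge0 ?(ltW e0)//; nra.
rewrite -(@ler_pXn2r _ 2) ?nnegrE ?(lam_ge0 _) ?mulr_ge0 ?(lam_ge0 _) ?(ltW sigma_gt0) ?sqrtr_ge0//.
rewrite [(2 * _) ^+ 2]exprMn !sqr_lam// mulrCA ler_wpM2l ?sqr_ge0//.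
have s01 : 2 / s0%:R <= 2 :> R.
  by rewrite ler_pdivrMr// ler_peMr// ler1n.
have s00 : 0 <= 2 / s0%:R :> R by rewrite divr_ge0.
have := logd_ge1; have := logm_ge1 qm; have := ler_wpM2l s00 MM.
by move: (2 / s0%:R) s01 s00 (M q) (M r) => a a1 a0 mq mr; nra.
Qed.

(** This is [s ^ s <= expR s * s`!] in disguise; the induction step is
    [ln (1 + 1 / s) <= 1 / s]. *)
Lemma sum_logm (s : nat) : (0 < s)%N ->
  \sum_(1 <= j < s.+1) M j <= s%:R * (M s + 1).
Proof.
case: s => // s _; elim: s => [|s IH].
  by rewrite big_nat1 mul1r; lra.
rewrite big_nat_recr//=; have MS : M s.+1 = M s.+2 + ln (s.+2%:R / s.+1%:R).
  rewrite -lnM ?posrE ?divr_gt0 ?mulr_gt0 ?ltr0n//; congr ln.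
  by rewrite mulrA divfK// pnatr_eq0.
have : s.+1%:R * ln (s.+2%:R / s.+1%:R) <= 1 :> R.
  rewrite mulrC -ler_pdivlMr ?ltr0n//.
  apply: le_trans (le1_ln _) _; first by rewrite divr_gt0 ?ltr0n.
  rewrite -[X in _ - X](@divff _ s.+1%:R) ?pnatr_eq0// -mulrBl ler_wpM2r//.
  by rewrite -[s.+2]addn1 natrD; lra.
move: IH; rewrite MS; move: (ln _) (M s.+2) => l M2 IH sl.
by rewrite -[s.+2%:R]natr1; lra.
Qed.

Lemma sum_sqr_tlam (s : nat) : (0 < s <= m)%N ->
  \sum_(1 <= i < (s * s0).+1) tlam sigma m d s0 i ^+ 2 <=
  4 * sigma ^+ 2 * (s%:R * M s + s%:R * s0%:R * L).
Proof.
move=> /andP[s_gt0 sm].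
have -> : \sum_(1 <= i < (s * s0).+1) tlam sigma m d s0 i ^+ 2 =
    s0%:R * \sum_(1 <= j < s.+1) lam sigma m d s0 j ^+ 2.
  rewrite !big_add1/=; elim: s sm {s_gt0} => [|s IH] sm.
    by rewrite mul0n !big_geq// mulr0.
  rewrite mulSnr (@big_cat_nat _ _ _ (s * s0))/= ?leq_addr// IH ?(ltnW sm)//.
  rewrite big_nat_recr//= mulrDr; congr (_ + _).
  rewrite -[X in \sum_(X <= _ < _) _]add0n big_addn addKn.
  rewrite (eq_big_nat _ _ (F2 := fun=> lam sigma m d s0 s.+1 ^+ 2)).
    by rewrite sumr_const_nat subn0 -[LHS]mulr_natl.
  move=> i /andP[_ i_lt]; rewrite tlamS divnDr ?dvdn_mull// mulnK// divn_small//.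
  by rewrite add0n (minn_idPl _).
have -> : \sum_(1 <= j < s.+1) lam sigma m d s0 j ^+ 2 =
    sigma ^+ 2 * (s%:R * L + 2 / s0%:R * \sum_(1 <= j < s.+1) M j).
  rewrite (eq_big_nat _ _ (F2 := fun j => sigma ^+ 2 * (L + 2 / s0%:R * M j))).
    rewrite -mulr_sumr big_split/= sumr_const_nat subSS subn0 -mulr_sumr.
    by rewrite -[L *+ s]mulr_natl.
  by move=> j /andP[j0 js]; rewrite sqr_lam// j0 (leq_trans _ sm).
rewrite mulrCA (mulrC 4) -[leRHS]mulrA ler_wpM2l ?sqr_ge0//.
rewrite mulrDr [_ * (_ / _ * _)]mulrA [_ * (_ / _)]mulrCA divff ?gt_eqF// mulr1.
have := sum_logm s_gt0; have := @logm_ge1 s; rewrite s_gt0 sm => /(_ isT).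
have := mulr_ge0 (mulr_ge0 (ltW s0R) (ler0n R s)) (le_trans ler01 logd_ge1).
have : 0 < s%:R :> R by rewrite ltr0n.
by move: (\sum_(_ <= _ < _) _) => S; nra.
Qed.

End Weights.

(** * The norm of the cone dominates the ranked atomic norms of the groups *)

Section StarNorm.
Context (R : realType) (sigma : R) (p m d s0 : nat) (G : 'I_m -> {set 'I_p}).
Hypotheses (sigma_gt0 : 0 < sigma) (m_gt0 : (0 < m)%N)
           (s0_gt0 : (0 < s0)%N) (s0d : (s0 <= d)%N) (groupG : grouping d G).

Lemma index_flatten_groups (gs : seq 'I_m) (j : 'I_m) (i : 'I_p) :
  j \in gs -> i \in G j ->
  (index i (flatten [seq enum (G k) | k <- gs]) < (index j gs).+1 * d)%N.
Proof.
move=> jgs iG; set k := index j gs.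
have kgs : (k < size gs)%N by rewrite index_mem.
have size_fl (l : seq 'I_m) : size (flatten [seq enum (G k) | k <- l]) = (size l * d)%N.
  elim: l => [|a l IH] //=; rewrite size_cat IH -cardE (groupG.1 a).
  by rewrite mulSn.
rewrite -(cat_take_drop k gs) map_cat flatten_cat index_cat.
case: ifPn => [ifl|ifl].
  rewrite -index_mem size_fl size_take kgs in ifl.
  by apply: leq_trans ifl _; rewrite leq_mul2r leqnSn orbT.
rewrite size_fl size_take kgs mulSn addnC ltn_add2r.
rewrite (drop_nth j kgs) /= index_cat mem_enum nth_index// iG.
by rewrite -[X in (_ < X)%N](groupG.1 j) cardE index_mem mem_enum.
Qed.

Lemma sum_groups (f : 'I_p -> R) : \sum_i f i = \sum_j \sum_(i in G j) f i.
Proof.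
under [RHS]eq_bigr do rewrite big_mkcond.
rewrite exchange_big; apply: eq_bigr => i _ /=.
have [j [ij juniq]] := groupG.2 i.
rewrite (bigD1 j)//= ij big1 ?addr0// => k kj.
by case: ifPn => // ik; move: kj; rewrite (juniq k ik) eqxx.
Qed.

Lemma perm_flatten_groups (gs : seq 'I_m) : perm_eq gs (enum 'I_m) ->
  perm_eq (flatten [seq enum (G k) | k <- gs]) (enum 'I_p).
Proof.
move=> pgs; have ugs : uniq gs by rewrite (perm_uniq pgs) enum_uniq.
apply: uniq_perm; last 2 first.
- exact: enum_uniq.
- move=> i; rewrite mem_enum; apply/flattenP.
  have [j [ij _]] := groupG.2 i; exists (enum (G j)).
    apply: map_f; rewrite (perm_mem pgs). by rewrite mem_enum.
  exact: etrans (mem_enum _ _) ij.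
elim: gs ugs {pgs} => [//|a l IH] /= /andP[al ul].
rewrite cat_uniq enum_uniq IH// andbT; apply/hasPn => i /flattenP[_ /mapP[b bl ->]].
rewrite !mem_enum => ib; apply/negP => /= ia.
have [j [_ ju]] := groupG.2 i.
by move: al; rewrite -(ju a ia) (ju b ib) bl.
Qed.

(** Both sums of [starnorm] are at least the weighted sums over any other ordering;
    take the groups in the order [gs], and the entries group by group in that
    order. *)
Lemma starnorm_ge (gs : seq 'I_m) (v : 'cV[R]_p) : perm_eq gs (enum 'I_m) ->
  \sum_j lam sigma m d s0 (index j gs).+1 *
     (Num.sqrt s0%:R * (2 * l2norm_on (G j) v +
        (\sum_(i in G j) `|v i 0|) / Num.sqrt s0%:R)) <=
  2 * starnorm sigma d s0 G v.
Proof.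
move=> pgs; have ugs : uniq gs by rewrite (perm_uniq pgs) enum_uniq.
have sq0 : Num.sqrt s0%:R != 0 :> R by rewrite gt_eqF// sqrtr_gt0 ltr0n.
have gsj j : j \in gs by rewrite (perm_mem pgs) mem_enum.
under eq_bigr do rewrite mulrDr [_ * (_ / _)]mulrC divfK// mulrDr.
rewrite big_split/= addrC /starnorm mulrDr.
have sum_gs (f : 'I_m -> R) : \sum_j f j = \sum_(j <- gs) f j.
  by rewrite [RHS](perm_big _ pgs)/= big_enum.
apply: lerD.
  set es := flatten [seq enum (G k) | k <- gs].
  have pes : perm_eq es (enum 'I_p) by exact: perm_flatten_groups.
  have ues : uniq es by rewrite (perm_uniq pes) enum_uniq.
  have := @sum_nth_largest R (tlam sigma m d s0) [seq `|v k 0| | k : 'I_p]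
    [seq `|v k 0| | k <- es] p (nonincr_tlam _ _ _ _).
  move=> /(_ sigma_gt0 m_gt0 s0_gt0).
  rewrite size_image card_ord => /(_ erefl (perm_map _ pes)).
  move=> /(ler_wpM2l (ler0n R 2)); apply: le_trans.
  have -> : wsum (fun i => tlam sigma m d s0 i.+1) [seq `|v k 0| | k <- es] =
      \sum_j \sum_(i in G j) tlam sigma m d s0 (index i es).+1 * `|v i 0|.
    rewrite -sum_groups.
    case: (posnP p) => [p0|p0].
      have -> : es = [::].
        by apply: size0nil; rewrite (perm_size pes) size_enum_ord.
      by rewrite big1// => i; have := ltn_ord i; rewrite [X in (_ < X)%N]p0.
    rewrite (wsum_map (Ordinal p0))//.
    by rewrite (perm_big _ pes)/= big_enum.
  rewrite mulr_sumr; apply: ler_sum => j _; rewrite !mulr_sumr.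
  apply: ler_sum => i iG; rewrite mulrA ler_wpM2r//.
  apply: (lam_le_tlam sigma_gt0) => //; last exact: index_flatten_groups.
  have : (index j gs < size gs)%N by rewrite index_mem.
  by rewrite (perm_size pgs) size_enum_ord.
have := @sum_nth_largest R (lam sigma m d s0) [seq l2norm_on (G k) v | k : 'I_m]
    [seq l2norm_on (G k) v | k <- gs] m (nonincr_lam _ _ sigma_gt0 m_gt0).
rewrite size_image card_ord => /(_ erefl (perm_map _ pgs)).
move=> /(ler_wpM2l (sqrtr_ge0 s0%:R)) /(ler_wpM2l (ler0n R 2)); apply: le_trans.
rewrite (wsum_map (Ordinal m_gt0))// -sum_gs !mulr_sumr.
by rewrite le_eqVlt; apply/orP; left; apply/eqP; apply: eq_bigr => j _; lra.
Qed.

End StarNorm.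

(** The element of rank [r] contributes no more than each of the [r] first ones. *)
Lemma sum_rank_ge (R : realType) (m : nat) (N : 'I_m -> R) (a : nat -> R)
    (gs : seq 'I_m) (j : 'I_m) :
  perm_eq gs (enum 'I_m) -> sorted (fun i k => N k <= N i) gs ->
  (forall i, 0 <= N i) -> (forall i, 0 <= a i) -> nonincr a ->
  (index j gs).+1%:R * (N j * a (index j gs)) <= \sum_i N i * a (index i gs).
Proof.
move=> pgs sgs N0 a0 na; set k := index j gs.
have ugs : uniq gs by rewrite (perm_uniq pgs) enum_uniq.
have jgs : j \in gs by rewrite (perm_mem pgs) mem_enum.
have kgs : (k < size gs)%N by rewrite index_mem.
have -> : \sum_i N i * a (index i gs) = \sum_(0 <= i < size gs) N (nth j gs i) * a i.
  transitivity (\sum_(i <- gs) N i * a (index i gs)).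
    by rewrite (perm_big _ pgs)/= big_enum.
  by rewrite (big_nth j) !big_mkord; apply: eq_bigr => i _; rewrite index_uniq.
rewrite (big_cat_nat (n := k.+1))//=.
apply: ler_wpDr; first by apply: sumr_ge0 => i _; rewrite mulr_ge0.
rewrite mulr_natl -[X in _ *+ X]subn0 -sumr_const_nat.
rewrite [leLHS]big_nat [leRHS]big_nat; apply: ler_sum => i /andP[_ ik].
apply: ler_pM => //; last by apply: na.
have := @sorted_leq_nth _ (fun i k => N k <= N i) _ _ j gs sgs i k.
rewrite nth_index//; apply => //; last by rewrite inE (@leq_ltn_trans k).
by move=> x y z xy yz; exact: le_trans yz xy.
Qed.

(** * The square root of the covariance contracts sparse vectors *)

Section SparseNormalization.
Context (R : realType).

Lemma sqnorm_mulmx_sym (k : nat) (B : 'M[R]_k) (x : 'cV[R]_k) :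
  B^T = B -> sqnorm (B *m x) = (x^T *m (B *m B) *m x) 0 0.
Proof.
move=> BT; have -> : x^T *m (B *m B) *m x = (B *m x)^T *m (B *m x).
  by rewrite trmx_mul BT !mulmxA.
rewrite mxE.
by apply: eq_bigr => i _; rewrite [_^T _ _]mxE expr2.
Qed.

(** An inequality is enough here, and it holds for the default value 0 of [sqrtmx]
    as well, so the existence of the square root is not an issue. *)
Lemma sqnorm_sqrtmx_le (k : nat) (A : 'M[R]_k) (x : 'cV[R]_k) :
  psdmx A -> sqnorm (sqrtmx A *m x) <= (x^T *m A *m x) 0 0.
Proof.
move=> [_ A0]; rewrite /sqrtmx; case: xgetP => [B _ [[BT _] BB]|_].
  by rewrite sqnorm_mulmx_sym// BB.
by rewrite mul0mx sqnorm0 A0.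
Qed.

Lemma opnorm_sqnorm (k : nat) (A : 'M[R]_k) (x : 'cV[R]_k) :
  opnorm A <= 1 -> sqnorm (A *m x) <= sqnorm x.
Proof.
move=> A1; have [x0|x0] := eqVneq (l2norm x) 0.
  by rewrite (l2norm_eq0 x0) mulmx0.
have {}x0 : 0 < l2norm x by rewrite lt_neqAle eq_sym x0 sqrtr_ge0.
pose y := (l2norm x)^-1 *: x.
have y1 : l2norm y <= 1.
  rewrite /l2norm -/(sqnorm y) sqnormZ -sqr_l2norm -exprMn mulVf ?gt_eqF//.
  by rewrite expr1n sqrtr1.
have Ay : l2norm (A *m y) <= 1.
  apply: le_trans A1; apply: ub_le_sup; last by exists y.
  exists (Num.sqrt (\sum_i (\sum_j `|A i j|) ^+ 2)) => _ [z z1 <-].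
  rewrite /l2norm ler_wsqrtr//; apply: ler_sum => i _.
  rewrite -real_normK ?num_real// lerXn2r ?nnegrE ?sumr_ge0//.
  rewrite mxE; apply: le_trans (ler_norm_sum _ _ _) _; apply: ler_sum => j _.
  rewrite normrM ler_piMr//.
  rewrite -(@ler_pXn2r _ 2) ?nnegrE// real_normK ?num_real// expr1n.
  have : l2norm z ^+ 2 <= 1 by rewrite exprn_ile1// sqrtr_ge0.
  rewrite sqr_l2norm /sqnorm (bigD1 j)//=; apply: le_trans.
  by rewrite lerDl sumr_ge0// => l _; exact: sqr_ge0.
have : sqnorm (A *m y) <= 1 by rewrite -sqr_l2norm exprn_ile1// sqrtr_ge0.
rewrite /y -scalemxAr sqnormZ exprVn mulrC ler_pdivrMr ?exprn_gt0//.
by rewrite mul1r sqr_l2norm.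
Qed.

(** Avoids the Cauchy-Schwarz inequality: [2 y (A y) <= y^2 + (A y)^2]
    coordinatewise. *)
Lemma quad_principal (p : nat) (S : {set 'I_p}) (A : 'M[R]_p) (x : 'cV[R]_p) :
  (forall i, i \notin S -> x i 0 = 0) -> opnorm (principal_submx S A) <= 1 ->
  (x^T *m A *m x) 0 0 <= sqnorm x.
Proof.
move=> xS A1; set AS := principal_submx S A in A1.
pose y : 'cV[R]_#|S| := \col_i x (enum_val i) 0.
have sumS (f : 'I_p -> R) : (forall i, i \notin S -> f i = 0) ->
    \sum_i f i = \sum_(i < #|S|) f (enum_val i).
  move=> fS; rewrite (bigID (mem S))/= [X in _ + X]big1; last by move=> i /fS.
  rewrite addr0; exact: (big_enum_val (A := mem S)).
have xy : sqnorm x = sqnorm y.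
  rewrite /sqnorm sumS => [|i iS]; last by rewrite xS// expr0n.
  by apply: eq_bigr => i _; rewrite mxE.
have -> : (x^T *m A *m x) 0 0 = \sum_i y i 0 * (AS *m y) i 0.
  rewrite -mulmxA mxE sumS => [|i iS]; last by rewrite mxE xS// mul0r.
  apply: eq_bigr => i _; rewrite !mxE; congr (_ * _).
  rewrite sumS => [|j jS]; last by rewrite xS// mulr0.
  by apply: eq_bigr => j _; rewrite !mxE.
have := opnorm_sqnorm y A1; rewrite xy /sqnorm => H.
have : \sum_i 2 * (y i 0 * (AS *m y) i 0) <=
    \sum_i (y i 0 ^+ 2 + (AS *m y) i 0 ^+ 2).
  apply: ler_sum => i _; have := sqr_ge0 (y i 0 - (AS *m y) i 0); nra.
rewrite -mulr_sumr big_split/=; lra.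
Qed.

Lemma sqnorm_sparse_le (p m d s0 : nat) (G : 'I_m -> {set 'I_p}) (A : 'M[R]_p)
    (S : {set 'I_p}) (j : 'I_m) (x : 'cV[R]_p) :
  psdmx A -> grouping d G -> (s0 <= d)%N ->
  (forall S, sparse_supports s0 G S -> opnorm (principal_submx S A) <= 1) ->
  S \subset G j -> (#|S| <= s0)%N -> (forall i, i \notin S -> x i 0 = 0) ->
  sqnorm (sqrtmx A *m x) <= sqnorm x.
Proof.
move=> Apsd [Gd _] s0d A1 SG Ss xS.
apply: le_trans (sqnorm_sqrtmx_le x Apsd) _.
have cGS : #|G j :\: S| = (d - #|S|)%N.
  by rewrite cardsD (finset.setIidPr SG) Gd.
have [|J [JG Jc _]] := @top_subset R _ (G j :\: S) (fun=> 0) (s0 - #|S|)%N.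
  by rewrite cGS; lia.
have SJ : (S :&: J)%SET = finset.set0.
  apply/finset.setP => i; rewrite !inE; apply/negP => /andP[iS iJ].
  by move: (fintype.subsetP JG i iJ); rewrite inE iS.
apply: (@quad_principal _ (S :|: J)%SET).
  by move=> i; rewrite finset.in_setU negb_or => /andP[/xS].
apply: A1; split; last first.
  exists j; rewrite finset.subUset SG/=; apply: fintype.subset_trans JG _.
  exact: finset.subsetDl.
by rewrite cardsU SJ cards0 subn0 Jc; lia.
Qed.

End SparseNormalization.

(** * Prior and posterior distributions on the letters *)

Lemma ln_pow2_le (R : realType) (k : nat) : ln (2 ^+ k) <= k%:R :> R.
Proof.
have ln21 : ln 2 <= 1 :> R by have := @le1_ln R 2; lra.
rewrite lnXn// -[leLHS]mulr_natl; have : 0 <= k%:R :> R by [].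
by move=> /ler_wpM2l/(_ _ _ ln21); rewrite mulr1.
Qed.

Lemma ln_ratio_le (R : realType) (x y : R) : 0 < x -> 0 < y ->
  ln (x / y) <= ln (4 * expR 1 * x / y).
Proof.
move=> x0 y0; rewrite ler_ln ?posrE ?divr_gt0 ?mulr_gt0 ?expR_gt0//.
rewrite ler_wpM2r ?invr_ge0 ?(ltW y0)// ler_peMl ?(ltW x0)//.
have : 1 <= expR 1 :> R by rewrite -[leLHS]expR0 ler_expR.
lra.
Qed.

Lemma ratio_le (R : realFieldType) (q e m A i : R) :
  0 <= e -> 0 <= m -> 0 <= A -> q <= i ->
  q * (2 * m * e * A) <= m * i * (2 * e) * A.
Proof.
move=> e0 m0 A0 qi; have c0 : 0 <= 2 * m * e * A by rewrite !mulr_ge0.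
have := ler_wpM2l c0 qi; lra.
Qed.

(** The entropy of a letter of scale [B] is of order [B ^+ 2]: [lm] is the cost of
    the group, [l2] that of the scale and [lA] that of the atom. *)
Lemma letter_budget (R : realFieldType) (s L M u B lm l2 lA : R) :
  0 < s -> 1 <= L -> 1 <= M -> 1 <= B -> u <= B -> 0 <= u ->
  u ^+ 2 = s * L + 2 * M -> lm <= M -> l2 <= B + 1 -> lA <= 4 * s * L ->
  lm + l2 + lA <= 7 * B ^+ 2.
Proof.
move=> s0 L1 M1 B1 uB u0 uE h1 h2 h3.
have uB2 : u ^+ 2 <= B ^+ 2 by rewrite lerXn2r ?nnegrE//; lra.
have BB : B <= B ^+ 2 by rewrite expr2 ler_peMl//; lra.
have : 0 <= s * L by rewrite mulr_ge0//; lra.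
lra.
Qed.

Section Posterior.
Context (R : realType) (p m d s0 : nat) (G : 'I_m -> {set 'I_p}).
Hypotheses (m_gt0 : (0 < m)%N) (s0_gt0 : (0 < s0)%N) (s0d : (s0 <= d)%N)
           (groupG : grouping d G).

Let mR : 0 < m%:R :> R. Proof. by rewrite ltr0n. Qed.
Let s0R : 0 < s0%:R :> R. Proof. by rewrite ltr0n. Qed.

(** [sqrt s0 * lambda_(k + 1) / sigma]: the weight of the group of rank [k + 1], with
    ranks counted from 0. *)
Definition mu (k : nat) : R :=
  Num.sqrt (s0%:R * ln (2 * expR 1 * d%:R / s0%:R) +
            2 * ln (4 * expR 1 * m%:R / k.+1%:R)).

Lemma sqr_mu (k : nat) : (k < m)%N -> mu k ^+ 2 =
  s0%:R * ln (2 * expR 1 * d%:R / s0%:R) +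
  2 * ln (4 * expR 1 * m%:R / k.+1%:R).
Proof.
move=> km; rewrite sqr_sqrtr// addr_ge0 ?mulr_ge0//.
  by apply: le_trans (logd_ge1 R s0_gt0 s0d); exact: ler01.
by apply: le_trans (@logm_ge1 R m m_gt0 k.+1 _); [exact: ler01|rewrite km].
Qed.

Lemma mu_ge1 (k : nat) : (k < m)%N -> 1 <= mu k.
Proof.
move=> km; rewrite -(@ler_pXn2r _ 2) ?nnegrE ?sqrtr_ge0// expr1n sqr_mu//.
have := @logm_ge1 R m m_gt0 k.+1; rewrite km => /(_ isT).
have : 0 <= s0%:R * ln (2 * expR 1 * d%:R / s0%:R) :> R.
  rewrite mulr_ge0//.
  by apply: le_trans (logd_ge1 R s0_gt0 s0d); exact: ler01.
lra.
Qed.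

Lemma mu_le (k : nat) : mu k <= mu 0.
Proof. by rewrite ler_wsqrtr// lerD2l ler_wpM2l//; exact: logm_le. Qed.

(** Letters carry an integer scale, close to the weight [mu] of the group they
    come from; a finite prior cannot accommodate the weights themselves without
    knowing the ranks of the groups. *)
Definition nscales : nat := (Num.truncn (mu 0)).+1.

(** Besides the triples (group, scale, atom) there is a null letter, which absorbs
    the probability left over by the posterior; this allows the same number of
    letters and the same global factor [c] for all vectors of the cone. *)
Definition letter : finType := option ('I_m * 'I_nscales * atom p s0).

Definition letter_vec (c : R) (l : letter) : 'cV[R]_p :=
  if l is Some (_, b, a) then (c * b.+1%:R) *: atom_vec R a else 0.

Definition natoms (j : 'I_m) : nat := #|[pred a : atom p s0 | is_atom (G j) a]|.

Definition prior (l : letter) : R :=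
  if l is Some (j, b, a) then
    if is_atom (G j) a
    then 2^-1 * m%:R^-1 * 2 ^- b.+1 * (natoms j)%:R^-1 else 0
  else 2^-1.

Lemma prior_ge0 (l : letter) : 0 <= prior l.
Proof.
case: l => [[[j b] a]|] /=; last by rewrite invr_ge0.
by case: ifP => // _; rewrite !mulr_ge0// ?invr_ge0// exprn_ge0.
Qed.

Lemma sum_letters (V : nmodType) (F : letter -> V) :
  \sum_l F l = F None + \sum_j \sum_b \sum_a F (Some (j, b, a)).
Proof.
rewrite !pair_bigA /= (bigD1 None)//=; congr (_ + _).
rewrite (reindex_omap Some id)/=; last by case.
by apply: eq_big => [[[j b] a]|[[j b] a] _] //=; rewrite eqxx.
Qed.

Lemma sum_prior_le1 : \sum_l prior l <= 1.
Proof.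
rewrite sum_letters /=.
suff : \sum_j \sum_b \sum_a prior (Some (j, b, a)) <= 2^-1 by rewrite /=; lra.
apply: (@le_trans _ _ (\sum_(j < m) 2^-1 * m%:R^-1)); last first.
  rewrite sumr_const card_ord -[leLHS]mulr_natl mulrCA divff ?mulr1//.
  by rewrite gt_eqF.
apply: ler_sum => j _.
apply: (@le_trans _ _ (\sum_(b < nscales) 2^-1 * m%:R^-1 * 2 ^- b.+1)).
  apply: ler_sum => b _; rewrite /= -big_mkcond/= sumr_const -/(natoms j).
  rewrite -[leLHS]mulr_natl mulrCA.
  have [->|n0] := eqVneq (natoms j) 0%N.
    by rewrite mul0r mulr0 !mulr_ge0// ?invr_ge0// exprn_ge0.
  by rewrite divff ?mulr1// pnatr_eq0.
rewrite -mulr_sumr ler_piMr ?mulr_ge0 ?invr_ge0//.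
rewrite -(big_mkord xpredT (fun b => 2 ^- b.+1 : R)).
elim: nscales => [|k IH]; first by rewrite big_geq.
rewrite big_nat_recl// expr1; under eq_bigr do rewrite exprS invfM.
rewrite -mulr_sumr; lra.
Qed.

(** The posterior picks the atom [a] of group [j] with probability
    [w j a / (H * b j)], where [w j] are the weights of the atoms in [xj j] and
    [b j] is [mu (idx j)] rounded up; multiplied by the factor [H / K * b j] of the
    letter and by [K], this gives back [w j a].  By the hypothesis on the ranks
    the probability of a letter of group [j] is at most [1 / (idx j).+1], so that
    its logarithm relative to the prior is at most of order [b j ^+ 2]
    ([letter_budget]); such terms sum to a constant, as [sum_j N j * b j <= 2 * H]. *)
Lemma posterior_exists (N : 'I_m -> R) (xj : 'I_m -> 'cV[R]_p) (v : 'cV[R]_p)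
    (idx : 'I_m -> nat) (H : R) (K : nat) :
  (forall j, atomic (@atom_vec R p s0) (is_atom (G j)) (N j) (xj j)) ->
  \sum_j xj j = v -> (forall j, (idx j < m)%N) ->
  0 < H -> \sum_j N j * mu (idx j) <= H ->
  (forall j, (idx j).+1%:R * (N j * mu (idx j)) <= H) -> (0 < K)%N ->
  exists rho : letter -> R, [/\ forall l, 0 <= rho l, \sum_l rho l = 1,
    forall l, 0 < rho l -> 0 < prior l,
    K%:R *: \sum_l rho l *: letter_vec (H / K%:R) l = v &
    \sum_l rho l * ln (rho l / prior l) <= 15 /\
    forall q (X : 'M[R]_(q, p)) D, 0 <= D ->
      (forall j (a : atom p s0), is_atom (G j) a -> sqnorm (X *m atom_vec R a) <= D) ->
      K%:R * \sum_l rho l * sqnorm (X *m letter_vec (H / K%:R) l) <=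
      2 * D * H ^+ 2 / K%:R].
Proof.
move=> repN xv idxm H0 NH rankN K0.
have KR : 0 < K%:R :> R by rewrite ltr0n.
have /choice[w wP] := repN.
have w0 j a : 0 <= w j a by case: (wP j).
have wA j a : ~~ is_atom (G j) a -> w j a = 0 by case: (wP j) => _ + _ _; apply.
have wN j : \sum_a w j a <= N j by case: (wP j).
have wx j : \sum_a w j a *: atom_vec R a = xj j by case: (wP j).
have N0 j : 0 <= N j by apply: le_trans (wN j); rewrite sumr_ge0.
have m1 j : 1 <= mu (idx j) by exact: mu_ge1.
have bP j : (Num.truncn (mu (idx j)) < nscales)%N.
  by rewrite ltnS le_truncn// mu_le.
pose b j : 'I_nscales := Ordinal (bP j).
pose br j : R := (b j).+1%:R.
have br_mu j : mu (idx j) <= br j <= 2 * mu (idx j).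
  have := m1 j; have /truncn_itv : 0 <= mu (idx j) by apply: le_trans (m1 j).
  by rewrite /br /= -natr1 => /andP[] *; apply/andP; split; lra.
have br1 j : 1 <= br j by have := m1 j; have := br_mu j => /andP[]; lra.
have br0 j : 0 < br j by have := br1 j; lra.
pose q j a := w j a / (H * br j).
have q0 j a : 0 <= q j a.
  by rewrite divr_ge0// mulr_ge0// ltW.
have sum_q (c : 'I_m -> R) : (forall j, 0 <= c j) ->
    \sum_j \sum_a q j a * c j <= H^-1 * \sum_j N j * (c j / br j).
  move=> c0; rewrite mulr_sumr; apply: ler_sum => j _.
  rewrite -mulr_suml -mulr_suml invfM.
  have := wN j; move=> /(ler_wpM2l (_ : 0 <= H^-1 * (c j / br j))).
  rewrite mulr_ge0 ?invr_ge0 ?divr_ge0 ?(ltW H0) ?(ltW (br0 j))// => /(_ isT).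
  by move: (\sum_a w j a) (H^-1) ((br j)^-1) => S h e; lra.
have q1 : \sum_j \sum_a q j a <= 1.
  have := sum_q (fun=> 1) (fun=> ler01); under eq_bigr do under eq_bigr do rewrite mulr1.
  move=> /le_trans; apply; rewrite mulrC ler_pdivrMr// mul1r.
  apply: le_trans NH; apply: ler_sum => j _; rewrite ler_wpM2l//.
  rewrite mul1r; apply: le_trans (m1 j).
  by rewrite invf_le1.
pose rho (l : letter) : R :=
  if l is Some (j, b', a) then if b' == b j then q j a else 0
  else 1 - \sum_j \sum_a q j a.
have rho_b (V : nmodType) (F : letter -> V) :
    (forall l, rho l = 0 -> F l = 0) ->
    \sum_l F l = F None + \sum_j \sum_a F (Some (j, b j, a)).
  move=> F0; rewrite sum_letters; congr (_ + _); apply: eq_bigr => j _.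
  rewrite (bigD1 (b j))//= [X in _ + X]big1 ?addr0// => b' b'b.
  by rewrite big1// => a _; rewrite F0//= (negPf b'b).
have rhoE j a : rho (Some (j, b j, a)) = q j a by rewrite /= eqxx.
have sum_qb (c : R) : 0 <= c ->
    \sum_j \sum_a q j a * (c * br j ^+ 2) <= c * 2.
  move=> c0; have := sum_q (fun j => c * br j ^+ 2).
  move=> /(_ (fun j => mulr_ge0 c0 (sqr_ge0 _))) /le_trans; apply.
  apply: (@le_trans _ _ (H^-1 * (c * (2 * H)))); last first.
    by rewrite mulrC -!mulrA divff ?mulr1// gt_eqF.
  rewrite ler_wpM2l ?invr_ge0 ?(ltW H0)//.
  apply: (@le_trans _ _ (c * (2 * \sum_j N j * mu (idx j)))); last first.
    by rewrite ler_wpM2l// ler_wpM2l.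
  rewrite !mulr_sumr; apply: ler_sum => j _.
  rewrite -mulrA expr2 mulfK ?gt_eqF//.
  have /andP[_] := br_mu j; move=> /(ler_wpM2l (mulr_ge0 c0 (N0 j))); lra.
exists rho; split.
- case=> [[[j b'] a]|] /=; first by case: ifP.
  by rewrite subr_ge0.
- rewrite rho_b//; under eq_bigr do under eq_bigr do rewrite rhoE.
  by rewrite /= subrK.
- case=> [[[j b'] a]|] /=; last by rewrite invr_gt0.
  case: eqP => [->|]; last by rewrite ltxx.
  case: ifPn => [Ha _|Ha]; last by rewrite /q wA// mul0r ltxx.
  rewrite !mulr_gt0// ?invr_gt0// ?exprn_gt0//.
  by rewrite ltr0n /natoms; apply/card_gt0P; exists a.
- rewrite rho_b; last by move=> l ->; rewrite scale0r.
  rewrite /= scaler0 add0r -xv scaler_sumr; apply: eq_bigr => j _.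
  rewrite -wx scaler_sumr; apply: eq_bigr => a _.
  rewrite eqxx !scalerA; congr (_ *: _); rewrite /q -/(br j).
  have kk (x y z t : R) : 0 < x -> 0 < y -> 0 < z ->
      x * (t / (y * z)) * (y / x * z) = t.
    move=> x0 y0 z0; rewrite [RHS](_ : t = t * (x / x) * (y / y) * (z / z)).
      by rewrite invfM; lra.
    by rewrite !divff ?gt_eqF// !mulr1.
  exact: kk.
split.
  rewrite rho_b; last by move=> l ->; rewrite mul0r.
  have T0 : rho None * ln (rho None / prior None) <= 1.
    have [->|r0] := eqVneq (rho None) 0; first by rewrite mul0r.
    have rN0 : 0 < rho None by rewrite lt_neqAle eq_sym r0 /= subr_ge0.
    have rN1 : rho None <= 1.
      by rewrite /= lerBlDr lerDl sumr_ge0// => j _; rewrite sumr_ge0.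
    have : ln (rho None / prior None) <= 1.
      apply: le_trans (le1_ln _) _; first by rewrite divr_gt0//= invr_gt0.
      by rewrite [prior _]/= invrK; lra.
    by move=> /(ler_wpM2l (ltW rN0)); rewrite mulr1; lra.
  suff : \sum_j \sum_a rho (Some (j, b j, a)) *
      ln (rho (Some (j, b j, a)) / prior (Some (j, b j, a))) <= 7 * 2.
    by move: T0; lra.
  apply: le_trans (sum_qb 7 _) => //.
  apply: ler_sum => j _; apply: ler_sum => a _; rewrite rhoE.
  have [->|qja] := eqVneq (q j a) 0; first by rewrite !mul0r.
  have Ha : is_atom (G j) a by apply: contraNT qja => /wA; rewrite /q => ->; rewrite mul0r.
  have {}qja : 0 < q j a by rewrite lt_neqAle eq_sym qja q0.
  rewrite ler_wpM2l// [prior _]/= Ha.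
  have nA : (0 < natoms j)%N by apply/card_gt0P; exists a.
  have nAR : 0 < (natoms j)%:R :> R by rewrite ltr0n.
  have kR : 0 < (idx j).+1%:R :> R by rewrite ltr0n.
  have e2 : 0 < 2 ^+ (b j).+2 :> R by rewrite exprn_gt0.
  have q_le : q j a <= (idx j).+1%:R^-1.
    rewrite /q ler_pdivrMr ?mulr_gt0// mulrC ler_pdivlMr//.
    have wNj : w j a <= N j.
      by apply: le_trans (wN j); rewrite (bigD1 a)//= lerDl sumr_ge0.
    apply: (@le_trans _ _ ((idx j).+1%:R * (N j * mu (idx j)))).
      rewrite mulrC ler_wpM2l// ?(ltW kR)//; apply: le_trans wNj _.
      by rewrite ler_peMr.
    by apply: le_trans (rankN j) _; rewrite ler_peMr// ltW.
  apply: (@le_trans _ _ (ln (m%:R / (idx j).+1%:R * (2 ^+ (b j).+2) * (natoms j)%:R))).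
    rewrite ler_ln ?posrE; last 2 first.
    - by rewrite divr_gt0// !mulr_gt0// ?invr_gt0// ?exprn_gt0.
    - exact: mulr_gt0 (mulr_gt0 (divr_gt0 mR kR) e2) nAR.
    rewrite !invfM !invrK [2 ^+ (b j).+2]exprS.
    by apply: ratio_le => //; rewrite exprn_ge0.
  rewrite (lnM (mulr_gt0 (divr_gt0 mR kR) e2) nAR) (lnM (divr_gt0 mR kR) e2).
  have lnm := ln_ratio_le mR kR.
  have ln2 := ln_pow2_le R (b j).+2; rewrite -[X in _ <= X]natr1 -/(br j) in ln2.
  have lnA := card_atoms R s0_gt0 s0d (groupG.1 j); rewrite -/(natoms j) in lnA.
  have lM := @logm_ge1 R m m_gt0 (idx j).+1.
  rewrite idxm in lM; have {}lM := lM isT.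
  have /andP[ub _] := br_mu j.
  apply: (letter_budget s0R (logd_ge1 R s0_gt0 s0d) lM (br1 j) ub _
            (sqr_mu (idxm j)) lnm ln2 lnA).
  exact: sqrtr_ge0.
move=> r X D D0 XD; rewrite rho_b; last by move=> l ->; rewrite mul0r.
rewrite [letter_vec _ None]/= mulmx0 sqnorm0 mulr0 add0r.
set c := H / K%:R.
apply: (@le_trans _ _ (K%:R * (c ^+ 2 * D * 2))); last first.
  rewrite /c expr_div_n -(@ler_pM2r _ K%:R)// mulfVK ?gt_eqF//.
  rewrite (_ : K%:R * _ * _ = (K%:R ^+ 2 / K%:R ^+ 2) * (2 * D * H ^+ 2)); last by lra.
  by rewrite divff ?mul1r// gt_eqF// exprn_gt0.
rewrite ler_wpM2l//; apply: le_trans (sum_qb (c ^+ 2 * D) _); last first.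
  by rewrite mulr_ge0// sqr_ge0.
apply: ler_sum => j _; apply: ler_sum => a _; rewrite rhoE.
have [Ha|/wA wja] := boolP (is_atom (G j) a); last by rewrite /q wja !mul0r.
rewrite ler_wpM2l// -scalemxAr sqnormZ exprMn -/(br j).
have := ler_wpM2l (mulr_ge0 (sqr_ge0 c) (sqr_ge0 (br j))) (XD j a Ha); lra.
Qed.

End Posterior.

(** * The favourable event *)

Lemma sqnorm_design (disp : measure_display) (T : measurableType disp)
    (R : realType) (P : probability T R) (n p : nat)
    (Z : 'I_n -> {RV P >-> p.-tuple R}) (w : T) (y : 'cV[R]_p) :
  sqnorm (row_matrix Z w *m y) = \sum_(i < n) tdot (Z i w) y ^+ 2.
Proof.
apply: eq_bigr => i _; rewrite mxE; congr (_ ^+ 2).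
by apply: eq_bigr => j _; rewrite mxE.
Qed.

(** Markov's inequality, for the complement. *)
Lemma prob_lt1_ge (disp : measure_display) (T : measurableType disp)
    (R : realType) (P : probability T R) (Q : T -> R) (q : R) :
  measurable_fun setT Q -> (forall w, 0 <= Q w) ->
  (\int[P]_w (Q w)%:E <= q%:E)%E ->
  measurable [set w | Q w < 1] /\ ((1 - q)%:E <= P [set w | (Q w < 1)%R])%E.
Proof.
move=> mQ Q0 Qq; set E := [set w | Q w < 1].
have mE : measurable E.
  rewrite -[X in measurable X]setTI (_ : E = Q @^-1` `]-oo, 1[%classic).
    exact: mQ.
  by apply/seteqP; split => w; rewrite /E /= in_itv.
split => //.
have mQE : measurable_fun [set: T] (fun w => (Q w)%:E) by exact/measurable_EFinP.
have PC : (P (~` E) <= q%:E)%E.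
  apply: le_trans Qq.
  have := @le_integral_abse _ _ _ P setT measurableT (fun w => (Q w)%:E) 1 mQE ltr01.
  rewrite mul1e setTI => H.
  have <- : (\int[P]_w `|(Q w)%:E| = \int[P]_w (Q w)%:E)%E.
    by apply: eq_integral => w _; rewrite /= ger0_norm.
  apply: le_trans H; rewrite le_eqVlt; apply/orP; left; apply/eqP.
  congr (P _); apply/seteqP; split => w; rewrite /E /=.
    by move=> /negP; rewrite -leNgt lee_fin ger0_norm.
  by rewrite lee_fin ger0_norm// => H'; apply/negP; rewrite -leNgt.
have PCE := probability_setC P mE; rewrite PCE in PC.
have fP : P E \is a fin_num by exact: fin_num_measure.
move: PC; rewrite -(fineK fP) -EFinB !lee_fin; lra.
Qed.

Section GoodEvent.
Context (disp : measure_display) (T : measurableType disp) (R : realType)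
        (P : probability T R) (p n m d s0 : nat) (alpha : R)
        (Z : 'I_n -> {RV P >-> p.-tuple R}) (G : 'I_m -> {set 'I_p})
        (B : 'M[R]_p).
Hypotheses (alpha_gt0 : 0 < alpha) (indepZ : mutually_independent Z)
           (isoZ : forall i, isotropic (Z i))
           (subZ : forall i, subgaussian alpha (Z i))
           (m_gt0 : (0 < m)%N)
           (B_atom : forall j (a : atom p s0), is_atom (G j) a ->
              sqnorm (B *m atom_vec R a) <= 4).

Let X w := row_matrix Z w *m B.

Let sqnormX w z : sqnorm (X w *m z) = \sum_(i < n) tdot (Z i w) (B *m z) ^+ 2.
Proof. by rewrite -mulmxA sqnorm_design. Qed.

Let mX z : measurable_fun setT (fun w => sqnorm (X w *m z)).
Proof.
under eq_fun do rewrite sqnormX; apply: measurable_sum => i.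
apply: measurable_funX; apply: (measurableT_comp (measurable_tdot _)).
exact: measurable_funP.
Qed.

(** One application of Markov's inequality to the sum of the average over the
    prior, divided by [expR t], and of the exponentials of
    [|X a|^2 / (4 alpha)^2] over all
    atoms [a], divided by [expR (4 * n)], controls all of them at once. *)
Lemma good_event (lambda beta t c : R) (K : nat) :
  0 < lambda -> beta = 1 - 64 * alpha ^+ 4 * lambda ->
  exists E : set T, [/\ measurable E,
    ((1 - (expR (- t) + (\sum_j natoms s0 G j)%:R * (2 ^+ n * expR (- (4 * n%:R)))))%:E
      <= P E)%E,
    forall w, E w -> avg (@letter_vec R p m d s0 c) (@prior R p m d s0 G) K
      (fun z => expR (- (lambda * sqnorm (X w *m z)) +
         n%:R * (lambda * beta * Num.min (sqnorm (B *m z)) 1))) 0 <= expR t &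
    forall w, E w -> forall j (a : atom p s0), is_atom (G j) a ->
      sqnorm (X w *m atom_vec R a) <= n%:R * (64 * alpha ^+ 2)].
Proof.
move=> l0 ->.
pose F w z := expR (- (lambda * sqnorm (X w *m z)) +
   n%:R * (lambda * (1 - 64 * alpha ^+ 4 * lambda) * Num.min (sqnorm (B *m z)) 1)).
have mF z : measurable_fun setT (F^~ z).
  apply: measurableT_comp => //; apply: measurable_funD => //.
  by apply: measurableT_comp => //; exact: measurable_funM.
have F1 z : (\int[P]_w (F w z)%:E <= 1)%E.
  under eq_integral do rewrite /F sqnormX.
  exact: sample_laplace.
pose W w := avg (@letter_vec R p m d s0 c) (@prior R p m d s0 G) K (F w) 0.
have mW : measurable_fun setT W by exact: measurable_avg.
have W0 w : 0 <= W w.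
  by apply: avg_ge0 => [l|z]; [exact: prior_ge0|exact: expR_ge0].
have W1 : (\int[P]_w (W w)%:E <= 1)%E.
  apply: integral_avg_le1 => //; first exact: prior_ge0.
  - exact: sum_prior_le1.
  - by move=> w z; exact: expR_ge0.
pose Y w (ja : 'I_m * atom p s0) := if is_atom (G ja.1) ja.2 then
   expR (sqnorm (X w *m atom_vec R ja.2) / (4 * alpha) ^+ 2) else 0.
have mY ja : measurable_fun setT (Y^~ ja).
  rewrite /Y; case: (is_atom _ _) => //; apply: measurableT_comp => //.
  exact: measurable_funM.
have Y0 w ja : 0 <= Y w ja by rewrite /Y; case: ifP => // _; exact: expR_ge0.
have Y1 ja : (\int[P]_w (Y w ja)%:E <=
    ((is_atom (G ja.1) ja.2)%:R * 2 ^+ n)%:E)%E.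
  rewrite /Y; have [Ha|Ha] := boolP (is_atom (G ja.1) ja.2); last first.
    by rewrite integral0 mul0r.
  rewrite mul1r; under eq_integral do rewrite sqnormX.
  apply: sample_exp_moment => //.
  have : l2norm (B *m atom_vec R ja.2) <= 2.
    rewrite -(@ler_pXn2r _ 2) ?nnegrE ?sqrtr_ge0// sqr_l2norm.
    by apply: le_trans (B_atom Ha) _; lra.
  by move=> /(ler_wpM2l (ltW alpha_gt0)); have := alpha_gt0; lra.
pose Q w := expR (- t) * W w + expR (- (4 * n%:R)) * \sum_ja Y w ja.
have mQ : measurable_fun setT Q.
  apply: measurable_funD; first exact: measurable_funM.
  by apply: measurable_funM => //; exact: measurable_sum.
have sY0 w : 0 <= \sum_ja Y w ja by exact: sumr_ge0.
have Q0 w : 0 <= Q w by rewrite addr_ge0// mulr_ge0// expR_ge0.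
have Qq : (\int[P]_w (Q w)%:E <= (expR (- t) +
   (\sum_j natoms s0 G j)%:R * (2 ^+ n * expR (- (4 * n%:R))))%:E)%E.
  under eq_integral do rewrite EFinD !EFinM.
  rewrite ge0_integralD//; last 4 first.
  - by move=> w _; rewrite -EFinM lee_fin mulr_ge0// expR_ge0.
  - by apply/measurable_EFinP; exact: measurable_funM.
  - by move=> w _; rewrite -EFinM lee_fin mulr_ge0// expR_ge0.
  - apply/measurable_EFinP; apply: measurable_funM => //.
    exact: measurable_sum.
  rewrite EFinD; apply: leeD.
    rewrite ge0_integralZl_EFin ?expR_ge0//; last 2 first.
    - by move=> w _; rewrite lee_fin.
    - exact/measurable_EFinP.
    by rewrite -[leRHS]mule1; apply: lee_wpmul2l; rewrite ?lee_fin ?expR_ge0.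
  rewrite ge0_integralZl_EFin ?expR_ge0//; last 2 first.
  - by move=> w _; rewrite lee_fin.
  - by apply/measurable_EFinP; exact: measurable_sum.
  rewrite mulrA (mulrC _ (expR _)) EFinM.
  apply: lee_wpmul2l; first by rewrite lee_fin expR_ge0.
  under eq_integral do rewrite -sumEFin.
  rewrite ge0_integral_sum//; last 2 first.
  - by move=> ja; exact/measurable_EFinP.
  - by move=> ja w _; rewrite lee_fin.
  apply: le_trans (lee_sum _ (fun ja _ => Y1 ja)) _.
  rewrite sumEFin lee_fin -mulr_suml ler_wpM2r ?exprn_ge0//.
  rewrite -natr_sum ler_nat /natoms.
  rewrite [leqLHS](_ : _ = \sum_j \sum_(a : atom p s0) is_atom (G j) a)%N; last first.
    by rewrite pair_bigA.
  apply: leq_sum => j _; rewrite -sum1_card [leqRHS]big_mkcond.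
  by apply: leq_sum => a _; rewrite inE; case: (is_atom _ _).
have [mE PE] := prob_lt1_ge mQ Q0 Qq.
exists [set w | Q w < 1]; split => //.
- move=> w /= Q1; rewrite -/(W w).
  have : expR (- t) * W w <= 1.
    apply: ltW; apply: le_lt_trans Q1; rewrite /Q lerDl.
    by rewrite mulr_ge0// expR_ge0.
  by rewrite expRN mulrC ler_pdivrMr ?expR_gt0// mul1r.
move=> w /= Q1 j a Ha.
have H1 : expR (- (4 * n%:R)) * Y w (j, a) <= 1.
  apply: ltW; apply: le_lt_trans Q1; rewrite /Q; apply: ler_wpDl.
    by rewrite mulr_ge0// expR_ge0.
  rewrite ler_wpM2l ?expR_ge0// (bigD1 (j, a))//= lerDl.
  exact: sumr_ge0.
move: H1; rewrite /Y /= Ha expRN mulrC ler_pdivrMr ?expR_gt0// mul1r ler_expR.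
rewrite ler_pdivrMr ?exprn_gt0 ?mulr_gt0//; lra.
Qed.

End GoodEvent.

(** * The lower bound on the cone *)

(** The ranks are those of the weights [N j] in decreasing order. *)
Lemma cone_gauge (R : realType) (sigma c0 : R) (p m d s s0 : nat)
    (G : 'I_m -> {set 'I_p}) (v : 'cV[R]_p) :
  0 < sigma -> 0 < c0 -> grouping d G -> (1 <= s <= m)%N -> (1 <= s0 <= d)%N ->
  wsgre_cone sigma d s s0 c0 G v ->
  let N j := 2 * l2norm_on (G j) v +
             (\sum_(i in G j) `|v i 0|) / Num.sqrt s0%:R in
  let A := s%:R * ln (4 * expR 1 * m%:R / s%:R) +
           s%:R * s0%:R * ln (2 * expR 1 * d%:R / s0%:R) in
  let H := 4 * (2 + c0) * Num.sqrt A * l2norm v in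
  exists idx : 'I_m -> nat, [/\ forall j, (idx j < m)%N,
    \sum_j N j * mu R m d s0 (idx j) <= H &
    forall j, (idx j).+1%:R * (N j * mu R m d s0 (idx j)) <= H].
Proof.
move=> sigma0 c00 groupG /andP[s_gt0 sm] /andP[s0_gt0 s0d] vC N A H.
have m_gt0 : (0 < m)%N by exact: leq_trans sm.
have N0 j : 0 <= N j.
  by apply: addr_ge0; [rewrite mulr_ge0 ?sqrtr_ge0|rewrite divr_ge0 ?sumr_ge0 ?sqrtr_ge0].
pose gs := sort (fun i k => N k <= N i) (enum 'I_m).
have pgs : perm_eq gs (enum 'I_m) by rewrite perm_sort.
have sgs : sorted (fun i k => N k <= N i) gs.
  by apply: sort_sorted => x y; exact: le_total.
have ixm j : (index j gs < m)%N.
  have : (index j gs < size gs)%N by rewrite index_mem (perm_mem pgs) mem_enum.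
  by rewrite (perm_size pgs) size_enum_ord.
have muE k : (k < m)%N ->
    mu R m d s0 k = Num.sqrt s0%:R * lam sigma m d s0 k.+1 / sigma.
  move=> km; rewrite /lam mulrCA mulrAC divff ?gt_eqF// mul1r -sqrtrM//.
  rewrite /mu mulrDr [s0%:R * (2 / _ * _)]mulrA [s0%:R * (2 / _)]mulrCA.
  by rewrite divff ?mulr1// pnatr_eq0 -lt0n.
have sumNH : \sum_j N j * mu R m d s0 (index j gs) <= H.
  have -> : \sum_j N j * mu R m d s0 (index j gs) =
      sigma^-1 * \sum_j lam sigma m d s0 (index j gs).+1 * (Num.sqrt s0%:R * N j).
    by rewrite mulr_sumr; apply: eq_bigr => j _; rewrite muE//; lra.
  have := starnorm_ge sigma0 m_gt0 s0_gt0 s0d groupG v pgs; rewrite -/(N _).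
  move=> /le_trans /(_ (ler_wpM2l (ler0n R 2) vC)).
  have sm1 : (0 < s <= m)%N by rewrite s_gt0.
  have tl2 := @sum_sqr_tlam R sigma m d s0 m_gt0 s0_gt0 s0d _ sm1.
  have A0 : 0 <= 4 * sigma ^+ 2 * A.
    by apply: le_trans tl2; apply: sumr_ge0 => i _; exact: sqr_ge0.
  have tA : Num.sqrt (\sum_(1 <= i < (s * s0).+1) tlam sigma m d s0 i ^+ 2) <=
      2 * sigma * Num.sqrt A.
    apply: (@le_trans _ _ (Num.sqrt (4 * sigma ^+ 2 * A))).
      by rewrite ler_wsqrtr.
    rewrite (_ : 4 * sigma ^+ 2 = (2 * sigma) ^+ 2); last by lra.
    by rewrite sqrtrM ?sqr_ge0// sqrtr_sqr ger0_norm ?mulr_ge0// ltW.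
  have nv0 : 0 <= l2norm v by exact: sqrtr_ge0.
  have c2 : 0 <= 2 * (2 + c0) * l2norm v by rewrite !mulr_ge0//; lra.
  have := ler_wpM2l c2 tA.
  set S := \sum_j _ ; move: (Num.sqrt (\sum_(_ <= _ < _) _)) => tl h1 h2.
  rewrite mulrC ler_pdivrMr// /H; lra.
exists (fun j => index j gs); split=> // j.
apply: le_trans sumNH.
have := @sum_rank_ge R m N (mu R m d s0) gs j pgs sgs N0.
apply; first by move=> k; exact: sqrtr_ge0.
move=> i k ik; rewrite ler_wsqrtr// lerD2l ler_wpM2l//; exact: logm_le.
Qed.


Lemma sample_size_bounds (R : realFieldType) (x D A N : R) :
  0 < x -> 0 < D -> 1 <= A -> (4 + x + D) * A < N ->
  [/\ x <= N, 4 * A <= N & D * A <= N].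
Proof.
move=> x0 D0 A1 AN.
have xA : x <= x * A by rewrite ler_peMr// ltW.
have DA : D <= D * A by rewrite ler_peMr// ltW.
by split; lra.
Qed.

(** Relative to [N * lambda], each of the six losses is at most [delta / 8]: those
    from [a4], from the parameter [delta / 8] of the cutoff, from the two
    variances, from the entropy [k] and from the deviation [t]. *)
Lemma lower_bound_arith (R : realFieldType) (N lambda delta a4 a2 e2 g k t S : R) :
  0 < delta -> delta < 1 -> 0 < lambda -> 0 <= a4 ->
  lambda * (8 * (a4 + 1)) = delta -> 0 <= a2 ->
  1024 * (e2 * (1 + a2)) = delta ^+ 2 -> 0 <= g -> g <= e2 -> 0 <= N ->
  k <= lambda * (N * (delta / 8)) -> t = lambda * (N * (delta / 8)) ->
  N * (lambda * (1 - a4 * lambda) *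
      (1 - delta / 8 - 2 / (delta / 8) * (2 * 4 * g))) - k - t <=
    lambda * (S + N * (128 * a2 * g)) ->
  N * (1 - delta) <= S.
Proof.
move=> d0 d1 l0 a40 lE a20 e2E g0 ge N0 kN tE low.
have e20 : 0 <= e2 by exact: le_trans ge.
have ae : 0 <= e2 * a2 by rewrite mulr_ge0.
have i8 : 2 / (delta / 8) * (2 * 4 * g) <= delta / 8.
  rewrite invf_div (_ : _ * (2 * 4 * g) = 128 * g / delta); last by lra.
  by rewrite ler_pdivrMr//; lra.
have b8 : 128 * a2 * g <= delta / 8.
  have := ler_wpM2l a20 ge; have : delta ^+ 2 <= delta by rewrite expr2 ler_piMl// ltW.
  by lra.
have beta1 : 1 - delta / 8 <= 1 - a4 * lambda by lra.
move: (2 / (delta / 8) * (2 * 4 * g)) i8 (1 - a4 * lambda) beta1 low => y i8 beta beta1 low.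
have bb : 1 - 3 * delta / 8 <= beta * (1 - delta / 8 - y).
  apply: (@le_trans _ _ ((1 - delta / 8) * (1 - delta / 4))); first by nra.
  by apply: ler_pM => //; lra.
rewrite -(ler_pM2l l0); have nl : 0 <= lambda * N by rewrite mulr_ge0// ltW.
have := ler_wpM2l nl bb; have := ler_wpM2l nl b8.
have := mulr_ge0 nl (ltW d0); lra.
Qed.

(** [ln m = ln (m / s) + ln s], and [ln s <= s - 1] is absorbed by the [s - 1]
    further copies of the logarithm. *)
Lemma ln_le_mul_logm (R : realType) (m s : nat) : (0 < s <= m)%N ->
  ln m%:R <= s%:R * ln (4 * expR 1 * m%:R / s%:R) :> R.
Proof.
move=> /andP[s_gt0 sm]; have m_gt0 : (0 < m)%N by exact: leq_trans sm.
have LM : 1 <= ln (4 * expR 1 * m%:R / s%:R) :> R by rewrite logm_ge1// s_gt0.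
have mR : 0 < m%:R :> R by rewrite ltr0n.
have sR : 0 < s%:R :> R by rewrite ltr0n.
have s1 : 0 <= s%:R - 1 :> R by rewrite subr_ge0 ler1n.
have h1 := ln_ratio_le mR sR; have h2 := le1_ln sR; have h3 := ler_wpM2l s1 LM.
have -> : ln m%:R = ln (m%:R / s%:R) + ln s%:R :> R.
  by rewrite -lnM ?posrE ?divr_gt0// divfK// gt_eqF.
lra.
Qed.

Lemma sum_natoms_le (R : realType) (p m d s0 : nat) (G : 'I_m -> {set 'I_p}) :
  (0 < m)%N -> (0 < s0)%N -> (s0 <= d)%N -> grouping d G ->
  (\sum_j natoms s0 G j)%:R <=
    expR (ln m%:R + 4 * s0%:R * ln (2 * expR 1 * d%:R / s0%:R)) :> R.
Proof.
move=> m_gt0 s0_gt0 s0d groupG; rewrite expRD lnK ?posrE ?ltr0n// natr_sum.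
rewrite (_ : m%:R * _ = \sum_(j < m) expR (4 * s0%:R * ln (2 * expR 1 * d%:R / s0%:R))).
  apply: ler_sum => j _.
  have [->|nA0] := posnP (natoms s0 G j); first exact: expR_ge0.
  have := card_atoms R s0_gt0 s0d (groupG.1 j); rewrite -/(natoms s0 G j).
  by rewrite -ler_expR lnK// posrE ltr0n.
by rewrite sumr_const card_ord -[RHS]mulr_natl.
Qed.

(** The constant 4 in the exponent pays for the [2 ^+ n], for the number [a] of atoms
    and for the remaining decay. *)
Lemma failure_prob_le (R : realType) (n : nat) (u a : R) :
  1 <= u -> u <= n%:R -> a <= expR n%:R ->
  expR (- (u + u)) + a * (2 ^+ n * expR (- (4 * n%:R))) <= expR (- u).
Proof.
move=> u1 un an.
have eu : expR (- u) <= 2^-1.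
  rewrite expRN lef_pV2 ?posrE ?expR_gt0//.
  by have := expR_ge1Dx u; lra.
have eu2 : expR (- (u + u)) <= 2^-1 * expR (- u).
  by rewrite opprD expRD ler_wpM2r// expR_ge0.
have two_le : 2 ^+ n <= expR n%:R :> R.
  rewrite -[X in expR X]mulr1 expRM_natl lerXn2r ?nnegrE ?expR_ge0//.
  by have := @expR_ge1Dx R 1; lra.
suff : a * (2 ^+ n * expR (- (4 * n%:R))) <= expR (- (u + u)) by lra.
apply: (@le_trans _ _ (expR n%:R * (expR n%:R * expR (- (4 * n%:R))))).
  apply: (@le_trans _ _ (expR n%:R * (2 ^+ n * expR (- (4 * n%:R))))).
    by rewrite ler_wpM2r// mulr_ge0 ?expR_ge0// exprn_ge0.
  by rewrite ler_wpM2l ?expR_ge0// ler_wpM2r ?expR_ge0.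
by rewrite -!expRD ler_expR; lra.
Qed.

(** [pac_bayes_lower] for [v / |B v|], with the posterior of [posterior_exists]. *)
Lemma cone_lower_bound (R : realType) (sigma c0 kappa : R) (p m d s s0 n K : nat)
    (G : 'I_m -> {set 'I_p}) (B : 'M[R]_p) (X : 'M[R]_(n, p)) (v : 'cV[R]_p)
    (alpha lambda beta eta t : R) :
  0 < sigma -> 0 < c0 -> 0 < kappa -> grouping d G ->
  (1 <= s <= m)%N -> (1 <= s0 <= d)%N -> (0 < K)%N ->
  0 < lambda -> 0 <= beta -> 0 < eta <= 1 ->
  (forall j (a : atom p s0), is_atom (G j) a -> sqnorm (B *m atom_vec R a) <= 4) ->
  (forall j (a : atom p s0), is_atom (G j) a ->
     sqnorm (X *m atom_vec R a) <= n%:R * (64 * alpha ^+ 2)) ->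
  let A := s%:R * ln (4 * expR 1 * m%:R / s%:R) +
           s%:R * s0%:R * ln (2 * expR 1 * d%:R / s0%:R) in
  let H := 4 * (2 + c0) / kappa * Num.sqrt A in
  0 < H ->
  avg (@letter_vec R p m d s0 (H / K%:R)) (@prior R p m d s0 G) K
    (fun z => expR (- (lambda * sqnorm (X *m z)) +
       n%:R * (lambda * beta * Num.min (sqnorm (B *m z)) 1))) 0 <= expR t ->
  wsgre_cone sigma d s s0 c0 G v -> 0 < l2norm (B *m v) ->
  kappa * l2norm v <= l2norm (B *m v) ->
  n%:R * (lambda * beta * (1 - eta - 2 / eta * (2 * 4 * (H ^+ 2 / K%:R)))) -
    15 * K%:R - t <=
  lambda * (sqnorm (X *m v) / sqnorm (B *m v) +
            n%:R * (128 * alpha ^+ 2 * (H ^+ 2 / K%:R))).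
Proof.
move=> sigma0 c00 k0 groupG sm s0d K0 l0 beta0 eta01 B_atom X_atom A H H0 EW vC nB0 kvB.
have [/andP[s_gt0 sm'] /andP[s0_gt0 s0d']] := (sm, s0d).
have m_gt0 : (0 < m)%N by exact: leq_trans sm'.
have KR : 0 < K%:R :> R by rewrite ltr0n.
set nB := l2norm (B *m v) in nB0 kvB.
pose v' := nB^-1 *: v.
have [idx [idxm sumN rankN]] := cone_gauge sigma0 c00 groupG sm s0d vC.
set N := (fun j => 2 * l2norm_on (G j) v + (\sum_(i in G j) `|v i 0|) /
           Num.sqrt s0%:R) in sumN rankN.
have nBH : nB^-1 * (4 * (2 + c0) * Num.sqrt A * l2norm v) <= H.
  rewrite mulrC ler_pdivrMr// /H.
  have := ler_wpM2l (ltW H0) kvB; rewrite /H.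
  rewrite (_ : _ / kappa * _ * (kappa * _) =
    (kappa / kappa) * (4 * (2 + c0) * Num.sqrt A * l2norm v)); last by lra.
  by rewrite divff ?mul1r// gt_eqF.
have iB0 : 0 <= nB^-1 by rewrite invr_ge0 ltW.
have sum_restr : \sum_j nB^-1 *: restr (G j) v = v'.
  rewrite -scaler_sumr; congr (_ *: _); apply/matrixP => i k.
  rewrite summxE ord1; have [j [ij ju]] := groupG.2 i.
  rewrite (bigD1 j)//= big1 ?addr0; first by rewrite mxE ij.
  move=> j' j'j; rewrite mxE; case: ifPn => // ij'.
  by move: j'j; rewrite (ju _ ij') eqxx.
have [|||rho [rho0 rho1 ac mv [KL VAR]]] := @posterior_exists R p m d s0 G
  m_gt0 s0_gt0 s0d' groupG (fun j => nB^-1 * N j) _ v' idx H K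
  (fun j => atomicZ iB0 (atomic_group s0_gt0 (G j) v)) sum_restr idxm H0.
- apply: le_trans nBH; apply: le_trans (ler_wpM2l iB0 sumN).
  by rewrite mulr_sumr; under eq_bigr do rewrite -mulrA.
- move=> j; apply: le_trans nBH; apply: le_trans (ler_wpM2l iB0 (rankN j)).
  by rewrite -mulrA mulrCA.
- by [].
have Bv1 : sqnorm (B *m v') = 1.
  rewrite -scalemxAr sqnormZ -sqr_l2norm -/nB -exprMn mulVf ?gt_eqF//.
  by rewrite expr1n.
have XVAR : K%:R * \sum_l rho l * sqnorm (X *m letter_vec (H / K%:R) l) <=
    n%:R * (128 * alpha ^+ 2 * (H ^+ 2 / K%:R)).
  apply: le_trans (VAR _ X (n%:R * (64 * alpha ^+ 2)) _ X_atom) _.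
    exact: mulr_ge0 (ler0n _ _) (mulr_ge0 (ler0n _ 64) (sqr_ge0 alpha)).
  by rewrite le_eqVlt; apply/orP; left; apply/eqP; lra.
have KK : K%:R * \sum_l rho l * ln (rho l / prior G l) <= 15 * K%:R.
  by rewrite mulrC ler_wpM2r// ltW.
have BVAR := VAR _ B 4 (ler0n _ 4) B_atom; rewrite -[leRHS]mulrA in BVAR.
have := pac_bayes_lower (prior_ge0 G) rho0 rho1 ac mv Bv1 l0 beta0 eta01
  BVAR XVAR KK EW.
suff -> : sqnorm (X *m v') = sqnorm (X *m v) / sqnorm (B *m v) by [].
by rewrite -scalemxAr sqnormZ mulrC exprVn /nB sqr_l2norm.
Qed.

Theorem theorem10 (R : realType) (alpha c0 kappa kappa' : R)
    (halpha : 0 < alpha) (hc0 : 0 < c0)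
    (hkappa : 0 < kappa < 1) (hkappa' : 0 < kappa' < kappa) :
  exists C1 C2 : R, [/\ 0 < C1, 0 < C2 &
    forall (p m d s s0 n : nat) (G : 'I_m -> {set 'I_p}) (sigma : R)
      (Sigma : 'M[R]_p) (disp : measure_display) (T : measurableType disp)
      (P : probability T R) (Z : 'I_n -> {RV P >-> p.-tuple R}),
      let cone := wsgre_cone sigma d s s0 c0 G `\ (0 : 'cV[R]_p) in
      let X := fun w => row_matrix Z w *m sqrtmx Sigma in
      p = (m * d)%N -> grouping d G ->
      (1 <= s <= m)%N -> (1 <= s0 <= d)%N -> 0 < sigma ->
      psdmx Sigma ->
      is_min_over cone (fun v => l2norm (sqrtmx Sigma *m v) / l2norm v) kappa ->
      (forall S, sparse_supports s0 G S -> opnorm (principal_submx S Sigma) <= 1) ->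
      mutually_independent Z -> identically_distributed Z ->
      (forall i, isotropic (Z i)) -> (forall i, subgaussian alpha (Z i)) ->
      C1 * (s%:R * ln (4 * expR 1 * m%:R / s%:R) +
            s%:R * s0%:R * ln (2 * expR 1 * d%:R / s0%:R)) < n%:R ->
      holds_with_prob_ge P (1 - expR (- C2 * n%:R))
        [set w | forall v, cone v -> kappa' <= empnorm (X w *m v) / l2norm v]].
Proof.
have [/andP[k0 k1] /andP[k'0 k'k]] := (hkappa, hkappa').
(* the fraction of the squared norm that may be lost *)
pose delta : R := 1 - (kappa' / kappa) ^+ 2.
have r0 : 0 < kappa' / kappa by rewrite divr_gt0.
have r1 : kappa' / kappa < 1 by rewrite ltr_pdivrMr// mul1r.
have d0 : 0 < delta by rewrite /delta subr_gt0 expr_lt1// ltW.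
have d1 : delta < 1 by rewrite /delta ltrBlDr ltrDl exprn_gt0.
pose a4 := 64 * alpha ^+ 4.
have a40 : 0 < a4 by rewrite mulr_gt0// exprn_gt0.
(* makes the second order term of the Laplace transform at most [delta / 8] *)
pose lambda := delta / (8 * (a4 + 1)).
have l0 : 0 < lambda by rewrite divr_gt0// mulr_gt0// ltr_wpDr.
have lE : lambda * (8 * (a4 + 1)) = delta by rewrite divfK// gt_eqF// mulr_gt0// ltr_wpDr.
have a20 : 0 < alpha ^+ 2 by rewrite exprn_gt0.
(* a name for 1024, which would otherwise be unfolded in unary *)
have [c cE] : exists c : R, c = 1024 by exists 1024.
have c0' : 0 < c * (1 + alpha ^+ 2) by rewrite mulr_gt0 ?addr_gt0// cE ltr0n.
(* target for [H ^+ 2 / K], which governs both variances *)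
pose e2 := delta ^+ 2 / (c * (1 + alpha ^+ 2)).
have e20 : 0 < e2 by rewrite divr_gt0// exprn_gt0.
have e2E : 1024 * (e2 * (1 + alpha ^+ 2)) = delta ^+ 2.
  by rewrite -cE mulrCA /e2 divfK// gt_eqF.
(* [H ^+ 2 = h * A] *)
pose h := (4 * (2 + c0) / kappa) ^+ 2.
have h0 : 0 < h by rewrite exprn_gt0// divr_gt0// mulr_gt0// addr_gt0.
have ld0 : 0 < lambda * delta by rewrite mulr_gt0.
have x0 : 0 < 16 / (lambda * delta) by rewrite divr_gt0.
(* makes the entropy, at most [15 * K], less than [t] *)
pose D1 := 120 * (h / e2 + 1) / (lambda * delta).
have D10 : 0 < D1 by rewrite divr_gt0// mulr_gt0 ?ltr0n// addr_gt0// divr_gt0.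
exists (4 + 16 / (lambda * delta) + D1), (lambda * delta / 16); split.
- by rewrite !addr_gt0.
- by rewrite divr_gt0.
move=> p m d s s0 n G sigma Sigma disp T P Z cone X _ groupG sm s0d sigma0.
move=> Spsd [_ kmin] Sparse indepZ _ isoZ subZ.
set A := _ + s%:R * s0%:R * _ => nA.
have [/andP[s_gt0 sm'] /andP[s0_gt0 s0d']] := (sm, s0d).
have m_gt0 : (0 < m)%N by exact: leq_trans sm'.
have LD : 0 <= ln (2 * expR 1 * d%:R / s0%:R) :> R.
  by apply: le_trans (logd_ge1 R s0_gt0 s0d'); exact: ler01.
have LM : 1 <= ln (4 * expR 1 * m%:R / s%:R) :> R by rewrite logm_ge1// s_gt0.
have A1 : 1 <= A.
  have LM0 := le_trans ler01 LM.
  rewrite -[leLHS]addr0 lerD// ?mulr_ge0//; apply: (le_trans LM).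
  by rewrite ler_peMl ?ler1n.
have [n16 n4 nD] := sample_size_bounds x0 D10 A1 nA.
have n0 : 0 < n%:R :> R by apply: lt_le_trans n16.
pose H := 4 * (2 + c0) / kappa * Num.sqrt A.
have A0 : 0 < A by exact: lt_le_trans A1.
have H0 : 0 < H.
  by rewrite mulr_gt0 ?sqrtr_gt0// divr_gt0// mulr_gt0// addr_gt0.
have HE : H ^+ 2 = h * A by rewrite exprMn sqr_sqrtr// ltW.
pose K := (Num.truncn (H ^+ 2 / e2)).+1.
have /andP[K_ge K_le] : H ^+ 2 / e2 <= K%:R <= H ^+ 2 / e2 + 1.
  have /truncn_itv/andP[h1 h2] : 0 <= H ^+ 2 / e2 by rewrite divr_ge0 ?sqr_ge0// ltW.
  by rewrite (ltW h2)/= -natr1 lerD2r.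
have KR : 0 < K%:R :> R by rewrite ltr0n.
have HK0 : 0 <= H ^+ 2 / K%:R by rewrite divr_ge0 ?sqr_ge0.
have HK : H ^+ 2 / K%:R <= e2.
  by rewrite ler_pdivrMr// mulrC -ler_pdivrMr.
pose t := lambda * (n%:R * (delta / 8)).
have Kn : 15 * K%:R <= t.
  have KA : K%:R <= (h / e2 + 1) * A.
    apply: le_trans K_le _; rewrite HE mulrDl mul1r mulrAC.
    by rewrite lerD2l.
  have : 120 * (h / e2 + 1) * A <= lambda * delta * n%:R.
    have := ler_wpM2l (ltW ld0) nD; apply: le_trans.
    by rewrite /D1 mulrA mulrCA divff ?mulr1// gt_eqF.
  move: KA; rewrite /t; move: (h / e2 + 1) => hh; clear; lra.
have B_atom j (a : atom p s0) : is_atom (G j) a ->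
    sqnorm (sqrtmx Sigma *m atom_vec R a) <= 4.
  move=> Ha; apply: le_trans (sqnorm_atom R s0_gt0 Ha).
  have [S [SG Ss aS]] := atom_supp R s0_gt0 Ha.
  exact: (sqnorm_sparse_le Spsd groupG s0d' Sparse SG Ss aS).
have [E [mE PE EW EA]] := @good_event _ T R P p n m d s0 alpha Z G (sqrtmx Sigma)
  halpha indepZ isoZ subZ m_gt0 B_atom lambda (1 - a4 * lambda) t
  (H / K%:R) K l0 erefl.
exists E; split => //; last first.
  apply: le_trans PE; rewrite lee_fin lerD2l lerN2 mulNr.
  set u := lambda * delta / 16 * n%:R.
  have -> : t = u + u by rewrite /t /u; clear; lra.
  apply: failure_prob_le.
  - have := ler_wpM2l (ltW ld0) n16; rewrite mulrCA divff ?gt_eqF// mulr1 /u.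
    by clear; lra.
  - rewrite /u ler_piMl ?ltW// ltr_pdivrMr// mul1r.
    apply: (@lt_trans _ _ 1); last by rewrite ltr1n.
    rewrite -[ltRHS]mulr1; apply: ltr_pM => //; try exact: ltW.
    rewrite /lambda ltr_pdivrMr ?mulr_gt0 ?addr_gt0//.
    by move: a40 d1; clear; lra.
  apply: le_trans (sum_natoms_le R m_gt0 s0_gt0 s0d' groupG) _.
  rewrite ler_expR; apply: le_trans n4.
  have := ln_le_mul_logm R sm; rewrite /A.
  have := ler_wpM2r (mulr_ge0 (ler0n R s0) LD) (_ : 1 <= s%:R :> R).
  rewrite ler1n s_gt0 => /(_ isT).
  move: (ln m%:R) (ln _) LM (ln _) (ler0n R s) => lm M LM L.
  by clear -LM; nra.
move=> w Ew v [vC /= v0] /=.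
have kv : kappa <= l2norm (sqrtmx Sigma *m v) / l2norm v by apply: kmin.
have nv : 0 < l2norm v.
  rewrite lt_neqAle sqrtr_ge0 andbT; apply/eqP => nv0.
  by apply: v0; exact: l2norm_eq0.
set nB := l2norm (sqrtmx Sigma *m v) in kv.
have kvB : kappa * l2norm v <= nB by rewrite -ler_pdivlMr.
have nB0 : 0 < nB by apply: lt_le_trans kvB; rewrite mulr_gt0.
have al1 : a4 * lambda <= 1.
  have : 0 < lambda * a4 by rewrite mulr_gt0.
  by move: lE d1 l0; clear; lra.
have eta01 : 0 < delta / 8 <= 1 by apply/andP; split; move: d0 d1; clear; lra.
have beta0 : 0 <= 1 - a4 * lambda by rewrite subr_ge0.
have low := cone_lower_bound sigma0 hc0 k0 groupG sm s0d (ltn0Sn _) l0 beta0 eta01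
  B_atom (EA w Ew) H0 (EW w Ew) vC nB0 kvB.
have XV := lower_bound_arith d0 d1 l0 (ltW a40) lE (ltW a20) e2E HK0 HK (ltW n0)
  Kn erefl low.
rewrite ler_pdivlMr// /empnorm -/(sqnorm _).
apply: (@le_trans _ _ (nB * (kappa' / kappa))).
  rewrite mulrA ler_pdivlMr// (mulrC nB) -[leLHS]mulrA.
  by rewrite ler_wpM2l ?(ltW k'0)// mulrC.
have nk0 := mulr_ge0 (ltW nB0) (ltW r0).
rewrite -[leLHS](ger0_norm nk0) -sqrtr_sqr.
rewrite ler_wsqrtr// [leRHS]mulrC ler_pdivlMr// exprMn.
move: XV; rewrite ler_pdivlMr -sqr_l2norm -/nB ?exprn_gt0// /delta.
by clear; lra.
Qed.
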